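(* Maintaining strong components via soft-threshold search takes $\mathrm{O}(m^{3/2})$ total time over $m$ arc additions: worst-case if each new threshold $s$ is always a median (or an approximate median) of the set of choices, and in expectation if each new $s$ is chosen uniformly at random from the set of choices.
   Context: Incremental setting: $n$ fixed vertices, initially no arcs; $m=\Omega(n)$ distinct arcs added one at a time. Goal: maintain the partition into strongly connected components, each with a canonical vertex; $f(x)$ denotes the canonical vertex of $x$'s component (disjoint-set structure with path compression and union by rank; treat each find/unite as $\mathrm{O}(1)$ amortized); and a list of canonical vertices in a topological order of the components, kept in a dynamic ordered list with $\mathrm{O}(1)$ amortized order queries, insertions and deletions. For each canonical vertex $x$ keep a circular doubly linked outgoing list of all arcs $(y,z)$ with $f(y)=x$ and incoming list of all arcs $(y,z)$ with $f(z)=x$; merging components concatenates these lists. Adding arc $(v,w)$: insert it in the lists; if $f(v)<f(w)$ stop. If $f(v)>f(w)$, run soft-threshold search from $f(w)$ (forward) and $f(v)$ (backward) on canonical vertices: $F=\{f(w)\}$, $B=\{f(v)\}$, $\mathit{out}(f(w))$, $\mathit{in}(f(v))$ = first arcs on the respective lists (null if empty), $s=f(v)$, $F_A=\{f(w)\}$ or $\{\}$ (if $\mathit{out}$ null), $B_A$ likewise, $F_P=B_P=\{\}$. While $F_A\ne\{\}$ and $B_A\ne\{\}$: choose any $u\in F_A$, $z\in B_A$. If $u<z$: let $(q,g)=\mathit{out}(u)$, $(h,r)=\mathit{in}(z)$, advance both pointers to the next arcs on their circular lists; $x=f(g)$, and if $\mathit{out}(u)$ returned to the first arc of $u$'s list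 remove $u$ from $F_A$; $y=f(h)$, and if $\mathit{in}(z)$ returned to the first arc of $z$'s list remove $z$ from $B_A$; if $u=x$ delete arc $(q,g)$ (a loop); if $y=z$ delete $(h,r)$; if $x\notin F$, add $x$ to $F$, set $\mathit{out}(x)$ to its first outgoing arc and add $x$ to $F_A$ if non-null; if $y\notin B$, symmetrically. (A component may be in both $F$ and $B$; no cycle test is made.) Otherwise: if $u>s$ move $u$ from $F_A$ to $F_P$; if $z<s$ move $z$ from $B_A$ to $B_P$. Then if $F_A=\{\}$: $B_P=\{\}$, remove $s$ from $B_A$, and if $F_P\ne\{\}$ choose new $s\in F_P$ and move all $x\in F_P$, $x\le s$, to $F_A$. If $B_A=\{\}$: $F_P=\{\}$, remove $s$ from $F_A$, and if $B_P\ne\{\}$ choose new $s\in B_P$ and move all $x\in B_P$, $x\ge s$, to $B_A$. After the search: $t=\min(\{f(v)\}\cup\{x\in F:\mathit{out}(x)\ne\text{null}\})$, $F_<=\{x\in F:x<t\}$, $B_>=\{y\in B:y>t\}$. Find the new component, if any, by a linear-time static strong-components computation on the graph with vertex set $X=F_<\cup\{t\}\cup B_>$ and arc set $Y$ consisting of $(f(u),f(x))$ for arcs $(u,x)$ with $f(u)\in F_<$, $f(u)\ne f(x)$, and $(f(y),f(z))$ for arcs $(y,z)$ with $f(z)\in B_>$, $f(y)\ne f(z)$; combine its old components into one with canonical vertex $f(v)$. Reorder: if $t=f(v)$ move $F_<$ just after $t$, else move $F_<$ just before $t$ and $B_>$ just before $F_<$, each internally in topological order; then delete from the list the vertices that are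 no longer canonical.
   Formalization: Iterations with u = z = s, which change nothing and can make the loop run forever, are skipped, and the search ends when F_A = B_A = {s}; the new arc (f(v), f(w)) is added to Y, since otherwise (X, Y) is acyclic and no new component would ever be found. *)

(* Defs.v *)
From mathcomp Require Import all_boot all_algebra.

Set Implicit Arguments.
Unset Strict Implicit.
Unset Printing Implicit Defensive.

(** * Programs with unit-cost ticks and two kinds of choice

    [Any P k]     a choice the algorithm leaves open: any [x] with [P x].
    [Thr r D k]   the choice of a new threshold in the set [D]; [r] is the
                  position in the current topological order, needed to speak
                  about medians of [D].
    [Halt]        execution cut off.  The only unbounded loop of the algorithm
                  carries a fuel, and the cost spent before a cut-off counts;
                  a bound uniform in the fuel therefore bounds every prefix of
                  every execution, and so also entails termination.

    A find, a union and an operation on the dynamic ordered list count as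
    constant time, in accordance with their amortized cost. *)
Inductive prog (n : nat) (A : Type) : Type :=
| Ret of A
| Halt
| Tick of nat & prog n A
| Any (T : Type) of (T -> Prop) & (T -> prog n A)
| Thr of ('I_n -> nat) & {set 'I_n} & ('I_n -> prog n A).

Arguments Ret {n A}.
Arguments Halt {n A}.

Fixpoint bind n A B (p : prog n A) (k : A -> prog n B) : prog n B :=
  match p with
  | Ret a => k a
  | Halt => Halt
  | Tick c q => Tick c (bind q k)
  | Any T P q => Any P (fun x => bind (q x) k)
  | Thr r D q => Thr r D (fun x => bind (q x) k)
  end.

(** [t] is the cost of some execution of [p] in which every threshold obeys
    [rule] and every open choice is resolved arbitrarily. *)
Fixpoint run_cost n A (rule : ('I_n -> nat) -> {set 'I_n} -> 'I_n -> Prop)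
    (p : prog n A) (t : nat) : Prop :=
  match p with
  | Ret _ | Halt => t = 0
  | Tick c q => exists2 t', run_cost rule q t' & t = c + t'
  | Any T P k => exists2 x, P x & run_cost rule (k x) t
  | Thr r D k => exists s, [/\ s \in D, rule r D s & run_cost rule (k s) t]
  end.

(** [e] is the expected cost of [p], each threshold being uniform in its set of
    choices, under some way of resolving the open choices; that way may depend
    on all earlier random outcomes. *)
Fixpoint expected_cost (R : realFieldType) n A (p : prog n A) (e : R) : Prop :=
  match p with
  | Ret _ | Halt => e = 0%R
  | Tick c q => exists2 e', expected_cost q e' & e = (c%:R + e')%R
  | Any T P k => exists2 x, P x & expected_cost (k x) e
  | Thr r D k => exists2 g : 'I_n -> R,
      (forall s, s \in D -> expected_cost (k s) (g s)) &
      e = ((\sum_(s in D) g s) / #|D|%:R)%R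
  end.

Definition is_median n (r : 'I_n -> nat) (S : {set 'I_n}) (s : 'I_n) : Prop :=
  #|S| <= 2 * #|[set x in S | r x <= r s]| /\
  #|S| <= 2 * #|[set x in S | r s <= r x]|.

Definition is_approx_median (R : realFieldType) (eps : R) n
    (r : 'I_n -> nat) (S : {set 'I_n}) (s : 'I_n) : Prop :=
  (eps * #|S|%:R <= #|[set x in S | (r x <= r s)%N]|%:R)%R /\
  (eps * #|S|%:R <= #|[set x in S | (r s <= r x)%N]|%:R)%R.

(** * Data structure *)

Notation darc n := ('I_n * 'I_n)%type.

(** A circular list is a sequence whose head is its first arc. *)
Record data (n : nat) := Data {
  fnd : 'I_n -> 'I_n;
  order : seq 'I_n;
  outl : 'I_n -> seq (darc n);
  inl : 'I_n -> seq (darc n) }.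

Definition pos n (d : data n) (x : 'I_n) : nat := index x (order d).

Definition before n (d : data n) (x y : 'I_n) : bool := pos d x < pos d y.

Definition init_data n (o : seq 'I_n) : data n :=
  Data id o (fun=> [::]) (fun=> [::]).

Definition insert_at (T : Type) (i : nat) (a : T) (l : seq T) : seq T :=
  take i l ++ a :: drop i l.

(** New arcs may be inserted anywhere in the lists. *)
Definition insert_arc n (d : data n) (a : darc n) (i j : nat) : data n :=
  let v := fnd d a.1 in
  let w := fnd d a.2 in
  Data (fnd d) (order d)
    (fun x => if x == v then insert_at i a (outl d x) else outl d x)
    (fun x => if x == w then insert_at j a (inl d x) else inl d x).

(** * One direction of a search

    [seen], [act], [pas], [ptr] are F, F_A, F_P, out in the forward direction
    and B, B_A, B_P, in in the backward direction.  A null pointer [None] on a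
    visited vertex means that no arc of its list is left to traverse. *)
Record side (n : nat) := Side {
  seen : {set 'I_n};
  act : {set 'I_n};
  pas : {set 'I_n};
  ptr : 'I_n -> option (darc n) }.

Definition empty_side n : side n := Side set0 set0 set0 (fun=> None).

(** Null when the successor of [a] on the circular list [l] is its first arc. *)
Definition advance n (l : seq (darc n)) (a : darc n) : option (darc n) :=
  let b := next l a in if ohead l == Some b then None else Some b.

(** If the pointer of [x] is at [a], move it past [a]; once it becomes null, [x]
    is no longer a candidate for the search. *)
Definition skip n (lists : 'I_n -> seq (darc n)) (x : 'I_n) (a : darc n)
    (sd : side n) : side n :=
  if ptr sd x == Some a then
    let p := advance (lists x) a in
    let dead := if p is None then [set x] else set0 in
    Side (seen sd) (act sd :\: dead) (pas sd :\: dead)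
      (fun y => if y == x then p else ptr sd y)
  else sd.

Definition visit n (lists : 'I_n -> seq (darc n)) (x : 'I_n)
    (sd : side n) : side n :=
  if x \in seen sd then sd else
  Side (x |: seen sd) (if lists x is [::] then act sd else x |: act sd) (pas sd)
    (fun y => if y == x then ohead (lists x) else ptr sd y).

Definition park n (x : 'I_n) (sd : side n) : side n :=
  Side (seen sd) (act sd :\ x) (x |: pas sd) (ptr sd).

(** * Soft-threshold search *)

Record search (n : nat) := Search {
  dat : data n;
  fw : side n;
  bw : side n;
  thr : 'I_n }.

(** A deleted loop disappears from both lists of its component [x]; a pointer of
    [x] that happens to be at it moves on to the next arc. *)
Definition delete_loop n (x : 'I_n) (a : darc n) (st : search n) : search n :=
  let d := dat st in
  Search
    (Data (fnd d) (order d)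
      (fun y => if y == x then rem a (outl d y) else outl d y)
      (fun y => if y == x then rem a (inl d y) else inl d y))
    (skip (outl d) x a (fw st)) (skip (inl d) x a (bw st)) (thr st).

(** The default branch is never taken: active vertices have non-null pointers. *)
Definition search_step n (u z : 'I_n) (st : search n) : search n :=
  if (ptr (fw st) u, ptr (bw st) z) is (Some a, Some b) then
    let x := fnd (dat st) a.2 in
    let y := fnd (dat st) b.1 in
    let st1 := Search (dat st) (skip (outl (dat st)) u a (fw st))
                 (skip (inl (dat st)) z b (bw st)) (thr st) in
    let st2 := if u == x then delete_loop u a st1 else st1 in
    let st3 := if y == z then delete_loop z b st2 else st2 in
    Search (dat st3) (visit (outl (dat st3)) x (fw st3))
      (visit (inl (dat st3)) y (bw st3)) (thr st3)
  else st.

Definition park_step n (u z : 'I_n) (st : search n) : search n :=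
  Search (dat st)
    (if before (dat st) (thr st) u then park u (fw st) else fw st)
    (if before (dat st) z (thr st) then park z (bw st) else bw st)
    (thr st).

(** The treatment of an empty active set, common to both directions: [mine] is
    the side whose active set is tested, and [le x s] says that the passive
    vertex [x] becomes active under the new threshold [s].  Clearing [pas other]
    and choosing [s] in and splitting [pas mine] are charged linear time. *)
Definition refill n (r : 'I_n -> nat) (le : rel 'I_n) (s : 'I_n)
    (mine other : side n) : prog n (side n * side n * 'I_n) :=
  if act mine != set0 then Ret (mine, other, s) else
  let other' := Side (seen other) (act other :\ s) set0 (ptr other) in
  Tick (1 + #|pas other| + #|pas mine|)
    (if pas mine == set0 then Ret (mine, other', s) else
     Thr r (pas mine) (fun s' =>
       let A := [set x in pas mine | le x s'] in
       Ret (Side (seen mine) A (pas mine :\: A) (ptr mine), other', s'))).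

Definition rethreshold n (st : search n) : prog n (search n) :=
  let r := pos (dat st) in
  bind (refill r (fun x s => r x <= r s) (thr st) (fw st) (bw st))
    (fun '(f, b, s) =>
  bind (refill r (fun x s => r x >= r s) s b f)
    (fun '(b', f', s') =>
  Ret (Search (dat st) f' b' s'))).

(** An iteration that picks [u = z = s] satisfies none of the tests and changes
    nothing.  Such void iterations are left out: they are not offered as a
    choice, and the loop ends if no other choice remains. *)
Definition finished n (st : search n) : bool :=
  [|| act (fw st) == set0, act (bw st) == set0 |
      (act (fw st) == [set thr st]) && (act (bw st) == [set thr st])].

Definition selectable n (st : search n) (uz : 'I_n * 'I_n) : Prop :=
  [/\ uz.1 \in act (fw st), uz.2 \in act (bw st) &
      ~ (uz.1 = thr st /\ uz.2 = thr st)].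

Fixpoint search_loop n (fuel : nat) (st : search n) : prog n (search n) :=
  if finished st then Ret st else
  if fuel is fuel'.+1 then
    Any (selectable st) (fun '(u, z) =>
      Tick 1
        (bind (rethreshold (if before (dat st) u z then search_step u z st
                            else park_step u z st))
          (search_loop fuel')))
  else Halt.

Definition init_search n (d : data n) (cv cw : 'I_n) : search n :=
  Search d (visit (outl d) cw (empty_side n)) (visit (inl d) cv (empty_side n))
    cv.

(** * Strong components and reordering after a search *)

Definition strong n (X : {set 'I_n}) (Y : seq (darc n)) : rel 'I_n :=
  let e := [rel x y | [&& x \in X, y \in X & (x, y) \in Y]] in
  [rel x y | connect e x y && connect e y x].

(** The component with at least two vertices, or the empty set if all strong
    components of [(X, Y)] are singletons. *)
Definition new_component n (X : {set 'I_n}) (Y : seq (darc n)) : {set 'I_n} :=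
  odflt set0 [pick K in equivalence_partition (strong X Y) X | 1 < #|K|].

Definition topological n (Y : seq (darc n)) (S : {set 'I_n})
    (l : seq 'I_n) : Prop :=
  perm_eq l (enum S) /\ pairwise (fun a b => (b, a) \notin Y) l.

(** [e] lists [K] in the order in which the arc lists are concatenated. *)
Definition merge n (K : {set 'I_n}) (c : 'I_n) (e : seq 'I_n)
    (d : data n) : data n :=
  let combine (lists : 'I_n -> seq (darc n)) x :=
    if x \in K then (if x == c then flatten (map lists e) else [::])
    else lists x in
  Data (fun x => if fnd d x \in K then c else fnd d x)
    [seq x <- order d | (x \notin K) || (x == c)]
    (combine (outl d)) (combine (inl d)).

Definition reorder n (cv t : 'I_n) (fl bl : seq 'I_n) (d : data n) : data n :=
  let o := if t == cv then
      let o' := [seq x <- order d | x \notin fl] in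
      let i := index t o' in take i.+1 o' ++ fl ++ drop i.+1 o'
    else
      let o' := [seq x <- order d | x \notin bl ++ fl] in
      let i := index t o' in take i o' ++ bl ++ fl ++ drop i o' in
  Data (fnd d) o (outl d) (inl d).

(** The new arc [(cv, cw)] is put in [Y] explicitly: as [cw <= t <= cv], neither
    of the two families of arcs defining [Y] contains it. *)
Definition restore n (cv cw : 'I_n) (st : search n) : prog n (data n) :=
  let d := dat st in
  let F := seen (fw st) in
  let B := seen (bw st) in
  let live := [set x in F | ptr (fw st) x != None] in
  let t := [arg min_(x < cv in cv |: live) pos d x] in
  let Flt := [set x in F | before d x t] in
  let Bgt := [set y in B | before d t y] in
  let X := t |: (Flt :|: Bgt) in
  let scan := flatten [seq outl d u | u <- enum Flt] ++
              flatten [seq inl d z | z <- enum Bgt] in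
  let Y := (cv, cw) :: [seq a <- [seq (fnd d b.1, fnd d b.2) | b <- scan] |
                        a.1 != a.2] in
  let K := new_component X Y in
  Tick (#|F| + #|B|)               (* t, F_< and B_> *)
 (Tick (#|X| + (size scan).+1)     (* static strong components *)
 (Tick (#|X| + (size scan).+1)     (* topological sorting of F_< and B_> *)
 (Any (fun '(fl, bl) => topological Y Flt fl /\ topological Y Bgt bl)
    (fun '(fl, bl) =>
  Tick (#|Flt| + #|Bgt|)           (* moves in the dynamic ordered list *)
 (Any (fun e : seq 'I_n => perm_eq e (enum K)) (fun e =>
  Tick #|K|                        (* unions, concatenations, deletions *)
 (Ret (merge K cv e (reorder cv t fl bl d))))))))).

Definition add_arc n (fuel : nat) (d : data n) (a : darc n) : prog n (data n) :=
  Tick 1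
    (Any (fun _ : nat * nat => True) (fun '(i, j) =>
      let d' := insert_arc d a i j in
      let cv := fnd d' a.1 in
      let cw := fnd d' a.2 in
      if before d' cw cv then
        bind (search_loop fuel (init_search d' cv cw)) (restore cv cw)
      else Ret d')).

Fixpoint add_arcs n (fuel : nat) (d : data n) (arcs : seq (darc n)) :
    prog n (data n) :=
  if arcs is a :: arcs' then
    bind (add_arc fuel d a) (fun d' => add_arcs fuel d' arcs')
  else Ret d.

(** Initialization of the [n] vertices, in the initial order [o], takes time [n]. *)
Definition maintain n (fuel : nat) (o : seq 'I_n) (arcs : seq (darc n)) :
    prog n (data n) :=
  Tick n (add_arcs fuel (init_data o) arcs).

(* Main.v *)
Require Import Defs.
From mathcomp Require Import all_boot all_algebra.
From mathcomp Require Import reals exp.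
From mathcomp Require Import all_order zify lra.

(** Call an ordered pair of arcs [(a, b)] related if some path leads from the head
    of [a] to the tail of [b].  A search with [k] steps pairs forward arcs leaving
    [u_i] with backward arcs entering [z_i], where [u_i < z_i] in the topological
    order.  The new arc leads from [z_i] to every [u_j], whereas no old path leads
    from [z_i] to [u_j] if [u_j <= u_i]; so about [k^2 / 2] ordered pairs become
    related.  There are at most [m^2] of them, and Cauchy-Schwarz bounds the total
    number of search steps by [O(m^(3/2))].  Counting ordered pairs makes this work
    even if the new arc creates cycles.

    Apart from the search steps, the cost of a search is that of parking vertices
    and choosing thresholds.  Before the next refill of the same side, either all
    active vertices up to the threshold die, or the passive ones and the threshold
    do; a central threshold makes both sets a constant fraction of the choices.
    For a random threshold this holds on average.

    The bound needs a valid topological order before each addition.  When the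
    search ends no live forward vertex precedes a live backward one; therefore
    [F_<] and [B_>] are completely explored, [X] contains every cycle through the
    new arc, and the reordering is again topological. *)

Set Implicit Arguments.
Unset Strict Implicit.
Unset Printing Implicit Defensive.

Import Order.TTheory GRing.Theory Num.Theory.

(** * Amortised budgets *)

Section Budget.
Local Open Scope ring_scope.
Variables (R : realFieldType) (n : nat).

Definition combiner := ('I_n -> nat) -> {set 'I_n} -> ('I_n -> R) -> R -> Prop.

(* [B] pays for every execution of [p], and what is left of it on return is
   described by [Q].  [comb] says how the budgets [b] of the branches of a
   threshold choice combine: by their maximum over the allowed thresholds, or by
   their mean. *)
Fixpoint budget (comb : combiner) A (p : prog n A) (Q : A -> R -> Prop)
    (B : R) : Prop :=
  match p with
  | Ret a => exists2 B', B' <= B & Q a B'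
  | Halt => 0 <= B
  | Tick c q => budget comb q Q (B - c%:R)
  | Any T P k => forall x, P x -> budget comb (k x) Q B
  | Thr r D k => exists2 b : 'I_n -> R,
      (forall s, s \in D -> budget comb (k s) Q (b s)) & comb r D b B
  end.

Definition ranks (r : 'I_n -> nat) (D : {set 'I_n}) (s : 'I_n) : nat :=
  minn #|[set x in D | (r x <= r s)%N]| #|[set x in D | (r s <= r x)%N]|.

(* All three threshold rules save, up to the factor [d], as much as the rank of the
   threshold counted from the nearer end: enough to pay three times for the set
   of choices. *)
Record central (d : nat) (comb : combiner) : Prop := Central {
  central_mono : forall r D b B B',
    comb r D b B -> B <= B' -> comb r D b B';
  central_ranks : forall r D B, D != set0 ->
    comb r D (fun s => B - (d * ranks r D s)%:R) (B - (3 * #|D|)%:R) }.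

Section Rules.
Variables (d : nat) (comb : combiner).
Hypothesis Hc : central d comb.

Lemma budget_le A (p : prog n A) Q B B' :
  budget comb p Q B -> B <= B' -> budget comb p Q B'.
Proof.
elim: p B B' => [a||c q IH|T P k IH|r D k IH] B B' /=.
- by case=> b lb Qb lB; exists b => //; apply: le_trans lB.
- exact: le_trans.
- by move=> Hq lB; apply: IH Hq _; rewrite lerD2r.
- by move=> Hk lB x Px; apply: IH (Hk x Px) lB.
- by case=> b Hb Hcb lB; exists b => //; apply: central_mono Hc _ _ _ _ _ Hcb lB.
Qed.

Lemma budget_weaken A (p : prog n A) (Q Q' : A -> R -> Prop) B :
  (forall a b, Q a b -> Q' a b) -> budget comb p Q B -> budget comb p Q' B.
Proof.
move=> QQ'; elim: p B => [a||c q IH|T P k IH|r D k IH] B //=.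
- by case=> b lb Qb; exists b => //; apply: QQ'.
- exact: IH.
- by move=> Hk x Px; apply/IH/Hk.
- by case=> b Hb Hcb; exists b => // s sD; apply/IH/Hb.
Qed.

Lemma budget_bind A A' (p : prog n A) (k : A -> prog n A') Q B :
  budget comb p (fun a b => budget comb (k a) Q b) B ->
  budget comb (bind p k) Q B.
Proof.
elim: p B => [a||c q IH|T P h IH|r D h IH] B //=.
- by case=> b lb Qb; apply: budget_le lb.
- exact: IH.
- by move=> Hk x Px; apply/IH/Hk.
- by case=> b Hb Hcb; exists b => // s sD; apply/IH/Hb.
Qed.

End Rules.

Definition run_comb (rule : ('I_n -> nat) -> {set 'I_n} -> 'I_n -> Prop) :
    combiner :=
  fun r D b B => forall s, s \in D -> rule r D s -> b s <= B.

Definition mean_comb : combiner :=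
  fun r D b B => D != set0 /\ \sum_(s in D) b s <= #|D|%:R * B.

Lemma run_cost_le rule A (p : prog n A) (Q : A -> R -> Prop) B t :
  (forall a b, Q a b -> 0 <= b) ->
  budget (run_comb rule) p Q B -> run_cost rule p t -> t%:R <= B.
Proof.
move=> Q0; elim: p B t => [a||c q IH|T P k IH|r D k IH] B t /=.
- by case=> b lb Qb ->; apply: le_trans lb; apply: Q0 Qb.
- by move=> B0 ->.
- by move=> Hq [t' /(IH _ _ Hq) lt' ->]; rewrite natrD; lra.
- by move=> Hk [x Px]; apply: IH; apply: Hk.
- case=> b Hb Hcb [s [sD rs Ht]].
  by apply: le_trans (Hcb s sD rs); apply: IH Ht; apply: Hb.
Qed.

Lemma expected_cost_le A (p : prog n A) (Q : A -> R -> Prop) B e :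
  (forall a b, Q a b -> 0 <= b) ->
  budget mean_comb p Q B -> expected_cost p e -> e <= B.
Proof.
move=> Q0; elim: p B e => [a||c q IH|T P k IH|r D k IH] B e /=.
- by case=> b lb Qb ->; apply: le_trans lb; apply: Q0 Qb.
- by move=> B0 ->.
- by move=> Hq [t' /(IH _ _ Hq) lt' ->]; lra.
- by move=> Hk [x Px]; apply: IH; apply: Hk.
- case=> b Hb [D0 Hcb] [g Hg ->].
  have D_gt0 : 0 < #|D|%:R :> R by rewrite ltr0n card_gt0.
  rewrite ler_pdivrMr // mulrC; apply: le_trans Hcb; apply: ler_sum => s sD.
  by apply: IH (Hg s sD); apply: Hb.
Qed.

Lemma run_central (rule : ('I_n -> nat) -> {set 'I_n} -> 'I_n -> Prop) d :
  (forall r (D : {set 'I_n}) s, s \in D -> rule r D s -> (3 * #|D| <= d * ranks r D s)%N) ->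
  central d (run_comb rule).
Proof.
move=> Hr; split=> [r D b B B' Hb lB s sD rs|r D B _ s sD rs].
  exact: le_trans (Hb s sD rs) lB.
by rewrite lerD2l lerN2 ler_nat; apply: Hr.
Qed.

(* The element of the left-hand set with the largest key dominates all of it. *)
Lemma few_low_ranks (D : {set 'I_n}) (key : 'I_n -> nat) j :
  (#|[set s in D | #|[set x in D | (key x <= key s)%N]| <= j]| <= j)%N.
Proof.
set S := [set s in D | _]; have [->|[s0 s0S]] := set_0Vmem S; first by rewrite cards0.
case: (@arg_maxnP _ s0 (mem S) key s0S) => s sS smax.
move: (sS); rewrite !inE => /andP[_]; apply: leq_trans.
apply/subset_leq_card/subsetP => x xS; have := smax x xS => /= le_x.
by move: xS; rewrite !inE le_x andbT => /andP[].
Qed.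

Lemma few_high_ranks (D : {set 'I_n}) (key : 'I_n -> nat) j :
  (#|[set s in D | #|[set x in D | (key s <= key x)%N]| <= j]| <= j)%N.
Proof.
set S := [set s in D | _]; have [->|[s0 s0S]] := set_0Vmem S; first by rewrite cards0.
case: (@arg_minnP _ s0 (mem S) key s0S) => s sS smin.
move: (sS); rewrite !inE => /andP[_]; apply: leq_trans.
apply/subset_leq_card/subsetP => x xS; have := smin x xS => /= le_x.
by move: xS; rewrite !inE le_x andbT => /andP[].
Qed.

Lemma sum_ranks r (D : {set 'I_n}) :
  (#|D| * #|D| <= 8 * \sum_(s in D) ranks r D s)%N.
Proof.
pose j := (#|D| %/ 4)%N.
pose S1 := [set s in D | (#|[set x in D | (r x <= r s)%N]| <= j)%N].
pose S2 := [set s in D | (#|[set x in D | (r s <= r x)%N]| <= j)%N].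
have c1 : (#|S1| <= j)%N := few_low_ranks D r j.
have c2 : (#|S2| <= j)%N := few_high_ranks D r j.
have le1 : (#|D :\: (S1 :|: S2)| * j.+1 <= \sum_(s in D) ranks r D s)%N.
  rewrite -sum_nat_const [X in (_ <= X)%N](big_setID (D :\: (S1 :|: S2))) /=.
  rewrite (setIidPr (subsetDl _ _)).
  apply: leq_trans (leq_addr _ _); apply: leq_sum => s.
  by rewrite !inE leq_min => /andP[+ sD]; rewrite sD /= negb_or -!ltnNge.
have : (#|D| <= #|D :\: (S1 :|: S2)| + 2 * j)%N.
  have := cardsID (S1 :|: S2) D; have := cardsUI S1 S2.
  have := subset_leq_card (subsetIr D (S1 :|: S2)); lia.
have : (#|D| < 4 * j.+1)%N by rewrite /j; lia.
have : (4 * j <= #|D|)%N by rewrite /j; lia.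
nia.
Qed.

Lemma mean_central : central 24 mean_comb.
Proof.
split=> [r D b B B' [D0 Hb] lB|r D B D0].
  by split=> //; apply: le_trans Hb _; rewrite ler_wpM2l.
split=> //; rewrite sumrB sumr_const -natr_sum -big_distrr /= mulrBr.
rewrite mulr_natl lerD2l lerN2 -natrM ler_nat.
rewrite mulnCA; have := sum_ranks r D; move: (_ * _)%N (bigop _ _ _) => p q. lia.
Qed.

End Budget.

(** * One side of a search *)

Lemma advance_cat n (l1 l2 : seq (darc n)) a :
  uniq (l1 ++ a :: l2) -> advance (l1 ++ a :: l2) a = ohead l2.
Proof.
move=> Ul.
have al1 : a \notin l1.
  by move: Ul; rewrite cat_uniq /= => /and3P[_]; rewrite negb_or => /andP[].
have idx : index a (l1 ++ a :: l2) = size l1.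
  by rewrite index_cat (negPf al1) /= eqxx addn0.
rewrite /advance next_nth mem_cat mem_head orbT idx.
case: l1 Ul al1 {idx} => [|c l1] /= Ul al1.
  case: l2 Ul => [|b l2] /=; first by rewrite eqxx.
  rewrite inE negb_or => /andP[/andP[ab _] _].
  by rewrite (inj_eq Some_inj) (negPf ab).
rewrite nth_cat ltnNge leqnSn /= subSnn /=.
case: l2 Ul => [|b l2] /=; first by rewrite eqxx.
rewrite mem_cat !inE => /andP[]; rewrite !negb_or => /and4P[_ _ cb _] _.
by rewrite (inj_eq Some_inj) (negPf cb).
Qed.

Definition delete n (x : 'I_n) (a : darc n) (L : 'I_n -> seq (darc n)) :=
  fun y => if y == x then rem a (L y) else L y.

Section Side.
Variables (n : nat) (G : {set darc n}) (nr fr : darc n -> 'I_n).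
Implicit Types (L : 'I_n -> seq (darc n)) (sd : side n) (tr : seq (darc n)).

(* Only loops may be missing from the lists. *)
Record lists_ok L : Prop := ListsOk {
  lists_uniq : forall x, uniq (L x);
  lists_sound : forall x a, a \in L x -> a \in G /\ nr a = x;
  lists_full : forall a, a \in G -> nr a != fr a -> a \in L (nr a) }.

Lemma delete_lists_ok L x a :
  nr a = fr a -> lists_ok L -> lists_ok (delete x a L).
Proof.
move=> loop [U S C]; split=> [y|y b|b bG nfb]; rewrite /delete.
- by case: eqP => // _; apply: rem_uniq.
- by case: eqP => _ => [/mem_rem|]; apply: S.
- case: eqP => _; last exact: C.
  rewrite mem_rem_uniq // inE C // andbT.
  by apply: contraNneq nfb => ->; apply/eqP.
Qed.

Variable P : 'I_n -> Prop.

(* [tr] lists the arcs traversed so far; in each list they come first. *)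
Record side_ok L tr sd : Prop := SideOk {
  trace_uniq : uniq tr;
  trace_sound : forall a, a \in tr -> a \in G /\ nr a \in seen sd;
  seen_prop : forall x, x \in seen sd -> P x;
  seen_split : forall x, x \in seen sd -> exists l1 l2,
    [/\ L x = l1 ++ l2, {subset l1 <= tr}, {in l2, forall a, a \notin tr} &
        ptr sd x = ohead l2];
  unseen_ptr : forall x, x \notin seen sd -> ptr sd x = None;
  cand_live : forall x, x \in act sd :|: pas sd -> ptr sd x != None }.

Lemma cand_seen L tr sd x :
  side_ok L tr sd -> x \in act sd :|: pas sd -> x \in seen sd.
Proof.
by move=> ok /(cand_live ok); apply: contraNT => /(unseen_ptr ok) ->.
Qed.

Lemma skip_seen L x a sd : seen (skip L x a sd) = seen sd.
Proof. by rewrite /skip; case: eqP. Qed.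

Lemma skip_ptr L x a sd : ptr sd x = Some a ->
  ptr (skip L x a sd) = fun y => if y == x then advance (L x) a else ptr sd y.
Proof. by rewrite /skip => ->; rewrite eqxx. Qed.

Lemma skip_cand L x a sd :
  (forall y, y \in act sd :|: pas sd -> ptr sd y != None) ->
  forall y, y \in act (skip L x a sd) :|: pas (skip L x a sd) ->
    ptr (skip L x a sd) y != None.
Proof.
move=> H y; rewrite /skip; case: eqP => [E|_] /=; last exact: H.
rewrite !inE -andb_orr => /andP[dead cy].
have [yx|yx] := eqVneq y x; last first.
  by apply: H; rewrite inE.
by case: (advance _ _) dead => //; rewrite yx inE eqxx.
Qed.

Lemma traverse_ok L tr sd u a : lists_ok L -> side_ok L tr sd ->
  ptr sd u = Some a ->
  [/\ side_ok L (a :: tr) (skip L u a sd), u \in seen sd, a \in L u &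
      a \notin tr].
Proof.
move=> Lok ok pu.
have us : u \in seen sd by apply: contraPT pu => /(unseen_ptr ok) ->.
have [l1 [l2 [Lu s1 s2]]] := seen_split ok us.
rewrite pu; case: l2 Lu s2 => // b l2 Lu s2 [Eb]; subst b.
have atr : a \notin tr by apply: s2; rewrite mem_head.
have aL : a \in L u by rewrite Lu mem_cat mem_head orbT.
have [aG na] := lists_sound Lok aL.
have UL : uniq (l1 ++ a :: l2) by rewrite -Lu (lists_uniq Lok).
split=> //; split=> /=.
- by rewrite atr (trace_uniq ok).
- by move=> b; rewrite inE skip_seen => /predU1P[->|/(trace_sound ok)//]; rewrite na.
- by move=> x; rewrite skip_seen; apply: (seen_prop ok).
- move=> x; rewrite skip_seen (skip_ptr _ pu) => xs.
  have [->|xu] := eqVneq x u.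
    exists (rcons l1 a), l2; split.
    + by rewrite cat_rcons.
    + move=> b; rewrite mem_rcons !inE => /predU1P[->|/s1 ->]; rewrite ?eqxx //.
      by rewrite orbT.
    + move=> b bl2; rewrite inE negb_or s2 ?inE ?bl2 ?orbT // andbT.
      apply: contraTneq bl2 => ->.
      by move: UL; rewrite cat_uniq /= => /and4P[].
    + by rewrite Lu advance_cat.
  have [m1 [m2 [Lx t1 t2 px]]] := seen_split ok xs.
  exists m1, m2; split=> // b bm; first by rewrite inE t1 // orbT.
  rewrite inE negb_or t2 // andbT; apply: contraNneq xu => E; subst b.
  have /(lists_sound Lok)[_ <-] : a \in L x by rewrite Lx mem_cat bm orbT.
  by rewrite na.
- move=> x; rewrite skip_seen (skip_ptr _ pu) => xs.
  by case: eqP xs => [->|_ /(unseen_ptr ok)//]; rewrite us.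
- by apply: skip_cand; apply: (cand_live ok).
Qed.

Lemma delete_ok L tr sd x a : (forall y, uniq (L y)) -> side_ok L tr sd ->
  side_ok (delete x a L) tr (skip L x a sd).
Proof.
move=> UL ok; split=> //.
- exact: (trace_uniq ok).
- by move=> b; rewrite skip_seen; apply: (trace_sound ok).
- by move=> y; rewrite skip_seen; apply: (seen_prop ok).
- move=> y; rewrite skip_seen => ys.
  have [l1 [l2 [Ly s1 s2 py]]] := seen_split ok ys.
  rewrite /delete; have [yx|yx] := eqVneq y x; last first.
    exists l1, l2; split=> //; rewrite -py /skip; case: eqP => //= _.
    by rewrite (negPf yx).
  subst y; exists (filter (predC1 a) l1), (filter (predC1 a) l2); split.
  + by rewrite rem_filter // Ly filter_cat.
  + by move=> b; rewrite mem_filter => /andP[_ /s1].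
  + by move=> b; rewrite mem_filter => /andP[_ /s2].
  + have := UL x; rewrite Ly /skip py.
    case: l2 Ly s2 py => [|b l2] Ly s2 py Ul /=; first by rewrite py.
    rewrite (inj_eq Some_inj); have [E|ba] := eqVneq b a; last by rewrite py.
    subst b; rewrite /= eqxx Ly advance_cat //.
    have al2 : a \notin l2 by move: Ul; rewrite cat_uniq /= => /and4P[].
    rewrite (_ : filter _ l2 = l2) //; apply/all_filterP/allP => b bl2 /=.
    by apply: contraNneq al2 => <-.
- move=> y; rewrite skip_seen => ys; have py := unseen_ptr ok ys.
  rewrite /skip; case: eqP => //= px; case: eqP => // yx.
  by rewrite yx px in py.
- by apply: skip_cand; apply: (cand_live ok).
Qed.

Lemma visit_ok L tr sd x : lists_ok L -> side_ok L tr sd -> P x ->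
  side_ok L tr (visit L x sd).
Proof.
move=> Lok ok Px; rewrite /visit; case: ifPn => // xs; split=> /=.
- exact: (trace_uniq ok).
- by move=> a /(trace_sound ok)[aG]; rewrite inE => ->; rewrite orbT.
- by move=> y; rewrite in_setU1 => /predU1P[->//|]; apply: (seen_prop ok).
- move=> y; rewrite in_setU1; have [->|yx] /= := eqVneq y x.
    move=> _; exists [::], (L x); split=> // a /(lists_sound Lok)[_ na].
    by apply: contra xs => /(trace_sound ok)[_]; rewrite na.
  exact: (seen_split ok).
- move=> y; rewrite in_setU1 negb_or => /andP[/negPf-> ys].
  exact: (unseen_ptr ok).
- move=> y; have [->|yx] := eqVneq y x.
    have xc : x \notin act sd :|: pas sd.
      by apply: contra xs; apply: cand_seen ok.
    by case: (L x) => [|b l] //; rewrite (negPf xc).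
  move=> yc; apply: (cand_live ok); move: yc.
  by case: (L x) => [|b l] //; rewrite !inE (negPf yx).
Qed.

Lemma park_ok L tr sd x : x \in act sd -> side_ok L tr sd ->
  side_ok L tr (park x sd).
Proof.
move=> xa ok; case: (ok) => *; split=> //= y yc; apply: (cand_live ok).
by move: yc; rewrite !inE; case: eqP => [->|_] /=; rewrite ?xa //.
Qed.

End Side.

(** * Thresholds and their potential *)

Lemma leq_mul_minn d p q p' q' k : p <= p' + k -> q <= q' + k ->
  d * minn p q <= d * minn p' q' + d * k.
Proof. by move=> lp lq; rewrite -mulnDr leq_mul2l; apply/orP; right; lia. Qed.

Section Threshold.
Variable n : nat.
Implicit Types (lt le : rel 'I_n) (sd f b : side n) (L : 'I_n -> seq (darc n)).

Definition cand sd := act sd :|: pas sd.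

(* The last clause justifies dropping vertices: they can no longer be paired. *)
Record threshold_ok lt (s : 'I_n) (f b : side n) : Prop := ThresholdOk {
  pas_after : forall x, x \in pas f -> lt s x;
  pas_before : forall y, y \in pas b -> lt y s;
  pairs_cand : forall x y, ptr f x != None -> ptr b y != None -> lt x y ->
    x \in cand f /\ y \in cand b }.

Lemma threshold_okC lt s f b :
  threshold_ok lt s f b -> threshold_ok (fun x y => lt y x) s b f.
Proof. by case=> H1 H2 H3; split=> // x y px py /(H3 y x py px)[]. Qed.

Definition evolves sd sd' :=
  [/\ forall x, ptr sd' x != None -> ptr sd x != None,
      forall x, x \in cand sd -> ptr sd' x != None -> x \in cand sd' &
      {subset pas sd' <= pas sd}].

Lemma evolves_trans sd1 sd2 sd3 :
  evolves sd1 sd2 -> evolves sd2 sd3 -> evolves sd1 sd3.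
Proof.
case=> p1 c1 s1 [p2 c2 s2]; split=> [x /p2/p1//|x xc px|x /s2/s1//].
by apply: c2 => //; apply: c1 => //; apply: p2.
Qed.

Lemma skip_evolves L x a sd : evolves sd (skip L x a sd).
Proof.
rewrite /skip; case: eqP => [px|_]; split=> //= y.
- by have [->|//] := eqVneq y x; rewrite px.
- have [->|yx] := eqVneq y x; rewrite /cand /= !inE -andb_orr => yc.
    by case: (advance _ _) => // b _; rewrite inE yc.
  by rewrite yc andbT; case: (advance _ _); rewrite inE ?(negPf yx).
- by rewrite inE => /andP[].
Qed.

Lemma visit_threshold_ok lt s f b f' b' L L' x y : transitive lt ->
  threshold_ok lt s f b -> evolves f f' -> evolves b b' ->
  (x \notin seen f' -> exists u, [/\ ptr f u != None & lt u x]) ->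
  (y \notin seen b' -> exists z, [/\ ptr b z != None & lt y z]) ->
  threshold_ok lt s (visit L x f') (visit L' y b').
Proof.
move=> lt_tr [T1 T2 T3] [fp fc fs] [bp bc bs] Hx Hy.
have visitE (M : 'I_n -> seq (darc n)) w sd z : ptr (visit M w sd) z != None ->
    ptr sd z != None \/ [/\ w \notin seen sd, z = w & z \in cand (visit M w sd)].
  rewrite /visit /cand; case: ifPn => [|ws] /=; first by left.
  have [->|zw] := eqVneq z w; last by left.
  by case: (M w) => // a l _; right; rewrite !inE eqxx.
have visit_cand (M : 'I_n -> seq (darc n)) w sd z : z \in cand sd -> z \in cand (visit M w sd).
  rewrite /visit /cand; case: ifP => //= _; rewrite !inE.
  by case: (M w) => // a l; rewrite !inE => /orP[]->; rewrite ?orbT.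
have visit_pas (M : 'I_n -> seq (darc n)) w sd : pas (visit M w sd) = pas sd.
  by rewrite /visit; case: ifP.
split=> [z|z|u z]; rewrite ?visit_pas.
- by move=> /fs/T1.
- by move=> /bs/T2.
- move=> /visitE[pu|[xf -> xc]] /visitE[pz|[yb -> yc]] lt_uz //.
  + have [uc zc] := T3 _ _ (fp _ pu) (bp _ pz) lt_uz.
    by split; apply: visit_cand; [apply: fc|apply: bc].
  + split=> //; have [w [pw lt_yw]] := Hy yb.
    have [uc _] := T3 _ _ (fp _ pu) pw (lt_tr _ _ _ lt_uz lt_yw).
    by apply: visit_cand; apply: fc.
  + split=> //; have [w [pw lt_wx]] := Hx xf.
    have [_ zc] := T3 _ _ pw (bp _ pz) (lt_tr _ _ _ lt_wx lt_uz).
    by apply: visit_cand; apply: bc.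
Qed.

Lemma park_threshold_ok lt s f b u z :
  u \in act f -> z \in act b -> threshold_ok lt s f b ->
  threshold_ok lt s (if lt s u then park u f else f)
    (if lt z s then park z b else b).
Proof.
move=> ua za [T1 T2 T3].
have park_cand sd w y (c : bool) : y \in cand sd ->
    y \in cand (if c then park w sd else sd).
  by case: c => //; rewrite /cand !inE; case: eqP => //= _; rewrite orbC.
split=> [x|y|x y].
- by case: ifP => [su|_]; [rewrite in_setU1 => /predU1P[->//|]|]; apply: T1.
- by case: ifP => [su|_]; [rewrite in_setU1 => /predU1P[->//|]|]; apply: T2.
- move=> px py /T3[||xc yc]; first by move: px; case: ifP.
    by move: py; case: ifP.
  by split; apply: park_cand.
Qed.

Variable d : nat.

(* An active vertex carries one unit for its next parking.  The minimum is the
   number of vertices that are certain to die before the next refill of the same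
   side: the refill is paid by the increase of this term, hence in advance by
   these deaths. *)
Definition phi le s sd : nat :=
  d.+1 * (#|act sd| + #|pas sd|) + #|act sd| -
  d * minn #|[set x in act sd | le x s]| (#|pas sd| + (s \in act sd)).

Lemma phi_le le s sd : phi le s sd <= d.+1 * (#|act sd| + #|pas sd|) + #|act sd|.
Proof. exact: leq_subr. Qed.

Lemma phi_visit le s L x sd : phi le s (visit L x sd) <= phi le s sd + d.+2.
Proof.
rewrite /phi /visit; case: ifP => _; first exact: leq_addr.
case: (L x) => [|a l] /=; first exact: leq_addr.
have le1 : #|[set x in act sd | le x s]| <= #|[set y in x |: act sd | le y s]| + 0.
  rewrite addn0; apply/subset_leq_card/subsetP => y.
  by rewrite !inE => /andP[-> ->]; rewrite orbT.
have le2 : #|pas sd| + (s \in act sd) <= #|pas sd| + (s \in x |: act sd) + 0.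
  by rewrite addn0 leq_add2l !inE; case: (s \in _); rewrite ?orbT.
have := leq_mul_minn d le1 le2; rewrite muln0 addn0.
have : #|x |: act sd| <= #|act sd|.+1 by rewrite cardsU1; case: (_ \notin _).
move: (d * _) (d * _) #|x |: act sd| #|act sd| => M M' p q; nia.
Qed.

Lemma phi_skip le s L x a sd : phi le s (skip L x a sd) <= phi le s sd.
Proof.
rewrite /skip; case: eqP => // _ /=; case: (advance _ _) => [b|].
  by rewrite !setD0.
rewrite /phi /=.
have E1 := cardsD1 x (act sd); have E2 := cardsD1 x (pas sd).
have E3 := cardsD1 x [set y in act sd | le y s].
have -> : [set y in act sd :\ x | le y s] = [set y in act sd | le y s] :\ x.
  by apply/setP => y; rewrite !inE andbA.
have le1 : #|[set y in act sd | le y s]| <=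
    #|[set y in act sd | le y s] :\ x| + ((x \in act sd) + (x \in pas sd)).
  by rewrite E3 addnC leq_add2l inE; case: (x \in act sd); case: (le x s).
have le2 : #|pas sd| + (s \in act sd) <=
    #|pas sd :\ x| + (s \in act sd :\ x) + ((x \in act sd) + (x \in pas sd)).
  have : (s \in act sd) <= (s \in act sd :\ x) + (x \in act sd).
    by rewrite !inE; case: eqP => [->|_] /=; lia.
  by rewrite E2 [(x \in pas sd) + _]addnC -!addnA leq_add2l
    [(x \in pas sd) + _]addnC addnA leq_add2r.
have := leq_mul_minn d le1 le2; rewrite E1 E2.
move: (d * minn _ _) (d * minn _ _) => M M'.
move: #|act sd :\ x| #|pas sd :\ x| (nat_of_bool _) (nat_of_bool _).
by move=> p q i j; nia.
Qed.

Lemma phi_park le s x sd : x \in act sd -> ~~ le x s -> x != s ->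
  phi le s (park x sd) < phi le s sd.
Proof.
move=> xa xs xns; rewrite /phi /park /=.
have E1 := cardsD1 x (act sd); rewrite xa in E1.
have E2 := cardsU1 x (pas sd).
have le1 : #|[set y in act sd | le y s]| <= #|[set y in act sd :\ x | le y s]| + 0.
  rewrite addn0; apply/subset_leq_card/subsetP => y; rewrite !inE => /andP[-> lys].
  by rewrite lys !andbT; apply: contraNneq xs => <-.
have le2 : #|pas sd| + (s \in act sd) <= #|x |: pas sd| + (s \in act sd :\ x) + 0.
  by rewrite addn0 E2 in_setD1 [s == x]eq_sym xns /= leq_add2r leq_addl.
have := leq_mul_minn d le1 le2; rewrite muln0 addn0 E1.
have lt1 : d * minn #|[set y in act sd | le y s]| (#|pas sd| + (s \in act sd))
    <= d.+1 * (#|act sd| + #|pas sd|).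
  rewrite leq_mul // geq_min; apply/orP; left; apply: leq_trans (leq_addr _ _).
  by apply/subset_leq_card/subsetP => y; rewrite inE => /andP[].
move: lt1; rewrite E1.
have : #|x |: pas sd| <= #|pas sd|.+1 by rewrite E2; case: (_ \notin _).
move: (d * minn _ _) (d * minn _ _) => M M'.
move: #|act sd :\ x| #|pas sd| #|x |: pas sd|.
by move=> p q r; rewrite -[nat_of_bool true]/1; nia.
Qed.

Definition drop_side s sd := Side (seen sd) (act sd :\ s) set0 (ptr sd).

Lemma phi_drop le le' s s' sd :
  phi le' s' (drop_side s sd) + #|pas sd| <= phi le s sd.
Proof.
rewrite /drop_side; apply: leq_trans (leq_add (phi_le _ _ _) (leqnn _)) _.
rewrite /phi /= cards0 addn0.
have E1 := cardsD1 s (act sd).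
have : d * minn #|[set x in act sd | le x s]| (#|pas sd| + (s \in act sd)) <=
    d * (#|pas sd| + (s \in act sd)).
  by rewrite leq_mul2l geq_minr orbT.
rewrite E1; move: (d * minn _ _) => M.
by move: #|act sd :\ s| #|pas sd| (nat_of_bool _) => p q i; nia.
Qed.

Definition refill_side le s sd :=
  let A := [set x in pas sd | le x s] in
  Side (seen sd) A (pas sd :\: A) (ptr sd).

Lemma phi_refill le s s' sd :
  act sd = set0 -> s' \in pas sd -> le s' s' ->
  phi le s' (refill_side le s' sd) +
    d * minn #|[set x in pas sd | le x s']|
             #|pas sd :\: [set x in pas sd | le x s']|.+1 <=
  phi le s sd + #|pas sd|.
Proof.
move=> a0 s'p s's'; rewrite /refill_side; set A := [set x in pas sd | le x s'].
rewrite /phi /= a0 !inE s'p s's' addn1.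
have -> : [set x in A | le x s'] = A.
  by apply/setP => x; rewrite !inE -andbA andbb.
have -> : #|[set x in set0 | le x s]| = 0.
  by apply/eqP; rewrite cards_eq0; apply/eqP/setP => x; rewrite !inE.
rewrite min0n muln0 subn0 cards0 addn0 add0n.
have E : #|pas sd| = #|A| + #|pas sd :\: A|.
  rewrite -(cardsID A (pas sd)); congr (_ + _); apply/eq_card => x.
  by rewrite !inE; case: (x \in pas sd).
have : d * minn #|A| #|pas sd :\: A|.+1 <= d * #|A|.
  by rewrite leq_mul2l geq_minl orbT.
rewrite E; move: (d * minn _ _) => M.
by move: #|A| #|pas sd :\: A| => p q; nia.
Qed.

Lemma ranks_le le r (D : {set 'I_n}) s :
  {in D &, injective r} -> s \in D ->
  (forall x y, le x y = (r x <= r y)) \/ (forall x y, le x y = (r y <= r x)) ->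
  ranks r D s <= minn #|[set x in D | le x s]| #|D :\: [set x in D | le x s]|.+1.
Proof.
move=> r_inj sD Hle; rewrite /ranks leq_min.
have bound (P : pred 'I_n) : (forall x, x \in D -> P x -> le x s -> x = s) ->
    #|[set x in D | P x]| <= #|D :\: [set x in D | le x s]|.+1.
  move=> PD; apply: (@leq_trans #|s |: (D :\: [set x in D | le x s])|); last first.
    by rewrite cardsU1; case: (_ \notin _).
  apply/subset_leq_card/subsetP => x; rewrite !inE => /andP[xD Px].
  by rewrite xD /= andbT -implyNb; apply/implyP; apply: contraNN => /(PD x xD Px) ->.
case: Hle => le_r.
  apply/andP; split; last first.
    rewrite geq_min; apply/orP; right; apply: bound => x xD sx; rewrite le_r => xs.
    by apply: r_inj => //; apply/eqP; rewrite eqn_leq xs.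
  by rewrite geq_min; apply/orP; left; apply/subset_leq_card/subsetP => x; rewrite !inE le_r.
apply/andP; split; last first.
  rewrite geq_min; apply/orP; left; apply: bound => x xD sx; rewrite le_r => xs.
  by apply: r_inj => //; apply/eqP; rewrite eqn_leq sx.
by rewrite geq_min; apply/orP; right; apply/subset_leq_card/subsetP => x; rewrite !inE le_r.
Qed.

Definition shrinks sd sd' :=
  [/\ seen sd' = seen sd, ptr sd' = ptr sd & {subset cand sd' <= cand sd}].

Lemma shrinks_trans sd1 sd2 sd3 :
  shrinks sd1 sd2 -> shrinks sd2 sd3 -> shrinks sd1 sd3.
Proof.
by case=> e1 p1 s1 [e2 p2 s2]; split=> [||x /s2/s1//]; rewrite ?e2 ?p2.
Qed.

Lemma shrinks_ok G nr P L tr sd sd' :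
  shrinks sd sd' -> side_ok G nr P L tr sd -> side_ok G nr P L tr sd'.
Proof.
by case=> Es Ep sub [*]; split; rewrite ?Es ?Ep // => x /sub; auto.
Qed.

Definition settled sd := act sd = set0 -> pas sd = set0.

Lemma refill_budget (R : realFieldType) (comb : combiner R n)
    r lt le le' s m o (b0 : R) : central d comb ->
  {in pas m &, injective r} ->
  (forall x y, le x y = (r x <= r y)) \/ (forall x y, le x y = (r y <= r x)) ->
  (forall x y, le x y = ~~ lt y x) -> transitive lt ->
  threshold_ok lt s m o ->
  budget comb (refill r le s m o)
    (fun '(m', o', s') (b : R) =>
      [/\ [/\ threshold_ok lt s' m' o', shrinks m m' & shrinks o o'],
          settled m', settled o -> settled o', act o' \subset act o &
          (b0 + (phi le s' m' + phi le' s' o' + (act m' != set0))%:R <= b)%R])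
    (b0 + (phi le s m + phi le' s o).+1%:R)%R.
Proof.
have shr sd : shrinks sd sd by split.
move=> Hc r_inj le_r le_lt lt_tr T; rewrite /refill; case: ifPn => [a0|].
  eexists; first exact: lexx; split=> //; last by rewrite a0 addn1.
  by move=> E; rewrite E eqxx in a0.
rewrite negbK => /eqP a0.
have dropS : shrinks o (drop_side s o).
  by split=> // x; rewrite /cand /drop_side !inE orbF => /andP[_ ->].
have drop_act : act (drop_side s o) \subset act o by apply: subsetDl.
case: eqP => [p0|/eqP p0] /=.
  eexists; first exact: lexx; split=> //.
    split=> //; split=> [x|y|x y] /=; rewrite ?p0 ?inE // => px py lt_xy.
    by case: T => _ _ /(_ x y px py lt_xy)[]; rewrite /cand a0 p0 !inE.
  rewrite a0 eqxx /= addn0 -addrA lerD2l lerBrDr -natrD ler_nat.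
  rewrite p0 cards0 addn0.
  have := phi_drop le' le' s s o.
  by move: (phi le s m) (phi le' s o) (phi le' s _) #|pas o| => i j k l; lia.
exists (fun s' => (b0 + (phi le s m + phi le' s o).+1%:R
  - (1 + #|pas o| + #|pas m|)%:R + (3 * #|pas m|)%:R
  - (d * ranks r (pas m) s')%:R)%R); last first.
  have := central_ranks Hc r (b0 + (phi le s m + phi le' s o).+1%:R
  - (1 + #|pas o| + #|pas m|)%:R + (3 * #|pas m|)%:R)%R p0.
  by rewrite addrK.
move=> s' s'p; eexists; first exact: lexx.
have s's' : le s' s' by case: le_r => ->.
have s'A : s' \in [set x in pas m | le x s'] by rewrite inE s'p.
rewrite -/(drop_side s o) -/(refill_side le s' m).
split=> //.
- split=> //; last first.
    by split=> // x; rewrite /cand /refill_side !inE a0 in_set0 /=;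
      case: (x \in pas m); rewrite ?andbF.
  split=> [x|y|x y].
  + rewrite /refill_side !inE => /andP[]; case: (x \in pas m) => //=.
    by rewrite le_lt negbK.
  + by rewrite inE.
  + move=> px py lt_xy; have [T1 T2 T3] := T.
    have [xc yc] := T3 x y px py lt_xy.
    have xp : x \in pas m by move: xc; rewrite /cand a0 set0U.
    split; first by rewrite /cand /refill_side /= !inE xp; case: (le x s').
    have lt_sy := lt_tr _ _ _ (T1 x xp) lt_xy.
    have irr : lt s s = false by apply/negbTE; rewrite -le_lt; case: le_r => ->.
    have ys : y != s by apply: contraTneq lt_sy => ->; rewrite irr.
    move: yc; rewrite /cand /= !inE orbF ys /= => /orP[//|/T2 lt_ys].
    by have := lt_tr _ _ _ lt_sy lt_ys; rewrite irr.
- by move=> E; have := s'A; rewrite (E : [set x in pas m | le x s'] = set0) inE.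
- have -> : act (refill_side le s' m) != set0 by apply/set0Pn; exists s'.
  have := phi_refill s a0 s'p s's'.
  have := leq_mul (leqnn d) (ranks_le r_inj s'p le_r).
  have := phi_drop le' le' s s' o.
  have : 0 < #|pas m| by rewrite card_gt0.
  set M := d * minn _ _; set N := d * _.
  move: (phi le s m) (phi le' s o) (phi le' s' _) (phi le s' _) => i j k l.
  move: #|pas m| #|pas o| => p q p0' H1 H2 H3.
  have H : l + k + 1 + N + (1 + q + p) <= (i + j).+1 + 3 * p by lia.
  have : ((l + k + 1 + N + (1 + q + p))%:R <= ((i + j).+1 + 3 * p)%:R :> R)%R.
    by rewrite ler_nat.
  rewrite (natrD _ _.+1) (natrD _ (_ + N)) (natrD _ _ N) -[nat_of_bool true]/1.
  move: (l + k + 1)%:R%R (1 + q + p)%:R%R (3 * p)%:R%R (i + j).+1%:R%R N%:R%R.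
  by move=> u v w x y; lra.
Qed.

End Threshold.

(** * Soft-threshold search *)

Definition lti n (o : seq 'I_n) : rel 'I_n := fun x y => index x o < index y o.

Lemma lti_trans n (o : seq 'I_n) : transitive (lti o).
Proof. by move=> y x z; apply: ltn_trans. Qed.

Lemma index_eq n (o : seq 'I_n) x y : x \in o -> index x o = index y o -> x = y.
Proof.
move=> xo E; have yo : y \in o by rewrite -index_mem -E index_mem.
by rewrite -(nth_index x xo) -(nth_index x yo) E.
Qed.

Definition conn n (G : {set darc n}) : rel 'I_n :=
  connect (fun x y => (x, y) \in G).

Lemma conn_arc n (G : {set darc n}) a : a \in G -> conn G a.1 a.2.
Proof. by case: a => x y aG; apply: connect1. Qed.

Lemma conn_refl n (G : {set darc n}) x : conn G x x.
Proof. exact: connect0. Qed.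

Lemma conn_trans n (G : {set darc n}) : transitive (conn G).
Proof. exact: connect_trans. Qed.

Lemma conn_sub n (G G' : {set darc n}) x y :
  G \subset G' -> conn G x y -> conn G' x y.
Proof.
move=> /subsetP sub; apply: connect_sub => u v uv.
exact/connect1/sub.
Qed.

Lemma conn_ind n (G : {set darc n}) (P : 'I_n -> Prop) x y :
  (forall a, a \in G -> P a.1 -> P a.2) -> conn G x y -> P x -> P y.
Proof.
move=> step /connectP[p]; elim: p x => [|z p IH] x /=; first by move=> _ ->.
by move=> /andP[xz pz] yl Px; apply: IH pz yl (step _ xz Px).
Qed.

Lemma conn_ind_r n (G : {set darc n}) (P : 'I_n -> Prop) x y :
  (forall a, a \in G -> P a.2 -> P a.1) -> conn G x y -> P y -> P x.
Proof.
by move=> step xy; apply: (conn_ind (P := fun z => P z -> P x) _ xy) => // a /step; auto.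
Qed.

Definition related n (G : {set darc n}) : {set darc n * darc n} :=
  [set p | [&& p.1 \in G, p.2 \in G & conn G p.1.2 p.2.1]].

Record comps_ok n (G : {set darc n}) (f : 'I_n -> 'I_n) (o : seq 'I_n) :
    Prop := CompsOk {
  find_idem : forall x, f (f x) = f x;
  order_uniq : uniq o;
  order_mem : forall x, (x \in o) = (f x == x);
  find_conn : forall x, conn G x (f x) && conn G (f x) x }.

Definition topo n (G : {set darc n}) (f : 'I_n -> 'I_n) (o : seq 'I_n) : Prop :=
  forall a, a \in G -> f a.1 = f a.2 \/ lti o (f a.1) (f a.2).

Lemma order_conn n (G : {set darc n}) f o x y :
  topo G f o -> conn G x y -> f x = f y \/ lti o (f x) (f y).
Proof.
move=> topoG xy.
apply: (conn_ind (P := fun z => f x = f z \/ lti o (f x) (f z)) _ xy); last by left.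
move=> a /topoG[->//|lt_a] [->|lt_x]; right=> //; exact: lti_trans lt_a.
Qed.

Record data_ok n (G : {set darc n}) (d : data n) : Prop := DataOk {
  data_comps : comps_ok G (fnd d) (Defs.order d);
  data_topo : topo G (fnd d) (Defs.order d);
  data_out : lists_ok G (fun a => fnd d a.1) (fun a => fnd d a.2) (outl d);
  data_in : lists_ok G (fun a => fnd d a.2) (fun a => fnd d a.1) (inl d) }.

Section Search.
Variables (n : nat) (G : {set darc n}) (v w : 'I_n).
Variables (f : 'I_n -> 'I_n) (o : seq 'I_n).
Let G' := (v, w) |: G.
Hypothesis comps : comps_ok G' f o.
Hypothesis Htopo : topo G f o.
Let nf (a : darc n) := f a.1.
Let nt (a : darc n) := f a.2.

Lemma find_order x : f x \in o.
Proof. by rewrite (order_mem comps) (find_idem comps). Qed.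

Definition fw_prop x : Prop := [/\ x \in o, conn G' w x & ~~ lti o x (f w)].
Definition bw_prop y : Prop := [/\ y \in o, conn G' y v & ~~ lti o (f v) y].

Lemma arc_lt a : a \in G' -> a = (v, w) \/ nf a = nt a \/ lti o (nf a) (nt a).
Proof. by rewrite in_setU1 => /predU1P[->|/Htopo]; [left|right]. Qed.

Lemma conn_nf a x : a \in G' -> conn G' x (nf a) -> conn G' x (nt a).
Proof.
move=> aG c; have /andP[_ c1] := find_conn comps a.1.
have /andP[c2 _] := find_conn comps a.2.
exact: conn_trans c (conn_trans c1 (conn_trans (conn_arc aG) c2)).
Qed.

Lemma conn_nt a x : a \in G' -> conn G' (nt a) x -> conn G' (nf a) x.
Proof. by move=> aG; apply: conn_trans; apply: conn_nf (connect0 _ _). Qed.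

Lemma fw_prop_nt a : a \in G' -> fw_prop (nf a) -> fw_prop (nt a).
Proof.
move=> aG [_ c ge]; split; [exact: find_order|exact: conn_nf c|].
have [E|[<- //|lt_a]] := arc_lt aG; first by rewrite E /nt /= /lti ltnn.
by apply: contra ge; apply: lti_trans.
Qed.

Lemma bw_prop_nf a : a \in G' -> bw_prop (nt a) -> bw_prop (nf a).
Proof.
move=> aG [_ c ge]; split; [exact: find_order|exact: conn_nt c|].
have [E|[-> //|lt_a]] := arc_lt aG; first by rewrite E /nf /= /lti ltnn.
by apply: contra ge => /lti_trans; apply.
Qed.

Lemma fw_prop_start : fw_prop (f w).
Proof.
split; first exact: find_order; last by rewrite /lti ltnn.
by have /andP[] := find_conn comps w.
Qed.

Lemma bw_prop_start : bw_prop (f v).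
Proof.
split; first exact: find_order; last by rewrite /lti ltnn.
by have /andP[] := find_conn comps v.
Qed.

Record core_ok (tF tB : seq (darc n)) (st : search n) : Prop := CoreOk {
  core_fnd : fnd (dat st) = f;
  core_order : Defs.order (dat st) = o;
  core_out : lists_ok G' nf nt (outl (dat st));
  core_in : lists_ok G' nt nf (inl (dat st));
  core_fw : side_ok G' nf fw_prop (outl (dat st)) tF (fw st);
  core_bw : side_ok G' nt bw_prop (inl (dat st)) tB (bw st) }.

(* [tp] lists the pairs of arcs traversed by the search steps. *)
Record search_ok (tp : seq (darc n * darc n)) (st : search n) : Prop := SearchOk {
  search_core : core_ok (map fst tp) (map snd tp) st;
  seen_fw : seen (fw st) =i f w :: [seq nt ab.1 | ab <- tp];
  seen_bw : seen (bw st) =i f v :: [seq nf ab.2 | ab <- tp];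
  search_thr : threshold_ok (lti o) (thr st) (fw st) (bw st);
  search_pairs : all (fun ab => lti o (nf ab.1) (nt ab.2)) tp }.

Variable d : nat.

Definition le_fw : rel 'I_n := fun x s => index x o <= index s o.
Definition le_bw : rel 'I_n := fun x s => index s o <= index x o.

Definition Phi st := phi d le_fw (thr st) (fw st) + phi d le_bw (thr st) (bw st).

Record follows (st st' : search n) : Prop := Follows {
  follows_fw : evolves (fw st) (fw st');
  follows_bw : evolves (bw st) (bw st');
  follows_seen_fw : seen (fw st') = seen (fw st);
  follows_seen_bw : seen (bw st') = seen (bw st);
  follows_thr : thr st' = thr st;
  follows_Phi : Phi st' <= Phi st }.

Lemma evolves_refl (sd : side n) : evolves sd sd. Proof. by split. Qed.

Lemma follows_refl st : follows st st. Proof. by split; try exact: evolves_refl. Qed.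

Lemma follows_trans st1 st2 st3 :
  follows st1 st2 -> follows st2 st3 -> follows st1 st3.
Proof.
case=> a1 b1 c1 d1 e1 f1 [a2 b2 c2 d2 e2 f2]; split; try congruence.
- exact: evolves_trans a2.
- exact: evolves_trans b2.
- exact: leq_trans f1.
Qed.

Lemma delete_loop_ok (c : bool) x a tF tB st :
  (c -> nf a = nt a) -> core_ok tF tB st ->
  let st' := if c then delete_loop x a st else st in
  core_ok tF tB st' /\ follows st st'.
Proof.
case: c => [/(_ isT) loop|_] [E1 E2 L1 L2 ok1 ok2]; last by split; [split|exact: follows_refl].
split; split=> //=.
- exact: delete_lists_ok.
- exact: delete_lists_ok.
- by apply: delete_ok => //; apply: lists_uniq L1.
- by apply: delete_ok => //; apply: lists_uniq L2.
- exact: skip_evolves.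
- exact: skip_evolves.
- by rewrite skip_seen.
- by rewrite skip_seen.
- by rewrite /Phi leq_add // phi_skip.
Qed.

Lemma search_step_ok tp st u z :
  search_ok tp st -> u \in act (fw st) -> z \in act (bw st) -> lti o u z ->
  exists ab, search_ok (ab :: tp) (search_step u z st) /\
    Phi (search_step u z st) <= Phi st + 2 * d.+2.
Proof.
case=> core sf sb T pairs ua za lt_uz.
have [E1 E2 L1 L2 ok1 ok2] := core.
have [a pa] : exists a, ptr (fw st) u = Some a.
  have := cand_live ok1 (x := u); rewrite inE ua => /(_ isT).
  by case: (ptr _ _) => // a _; exists a.
have [b pb] : exists b, ptr (bw st) z = Some b.
  have := cand_live ok2 (x := z); rewrite inE za => /(_ isT).
  by case: (ptr _ _) => // b _; exists b.
have [okF us aL aF] := traverse_ok L1 ok1 pa.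
have [okB zs bL bB] := traverse_ok L2 ok2 pb.
have [aG na] := lists_sound L1 aL; have [bG nb] := lists_sound L2 bL.
exists (a, b); rewrite /search_step pa pb E1.
set st1 := Search _ (skip _ _ _ _) (skip _ _ _ _) _.
have core1 : core_ok (a :: map fst tp) (b :: map snd tp) st1 by split.
have fol1 : follows st st1.
  split; rewrite ?skip_seen //=; try exact: skip_evolves.
  by rewrite /Phi leq_add // phi_skip.
have loop_a : u == f a.2 -> nf a = nt a by move/eqP; rewrite -na.
have loop_b : f b.1 == z -> nf b = nt b by move/eqP; rewrite -nb.
set st2 := if u == f a.2 then _ else _.
have [core2 fol2] : core_ok (a :: map fst tp) (b :: map snd tp) st2 /\ follows st st2.
  have [c2 f2] := delete_loop_ok u loop_a core1.
  by split=> //; apply: follows_trans f2.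
set st3 := if f b.1 == z then _ else _.
have [core3 fol3] : core_ok (a :: map fst tp) (b :: map snd tp) st3 /\ follows st st3.
  have [c3 f3] := delete_loop_ok z loop_b core2.
  by split=> //; apply: follows_trans f3.
have [F1 F2 M1 M2 k1 k2] := core3.
have [ev1 ev2 s1 s2 t3 p3] := fol3.
have seen_visit (L : 'I_n -> seq (darc n)) x sd : seen (visit L x sd) =i x |: seen sd.
  move=> y; rewrite /visit; case: ifP => //= xs; rewrite in_setU1.
  by case: eqP => [->|].
split; [split=> /=|].
- split=> //=.
  + by apply: (visit_ok M1) => //; apply: (fw_prop_nt aG); rewrite na; apply: (seen_prop ok1).
  + by apply: (visit_ok M2) => //; apply: (bw_prop_nf bG); rewrite nb; apply: (seen_prop ok2).
- by move=> y; rewrite seen_visit in_setU1 s1 sf !inE orbCA.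
- by move=> y; rewrite seen_visit in_setU1 s2 sb !inE orbCA.
- rewrite t3; apply: (visit_threshold_ok _ _ (@lti_trans _ o) T) => //.
  + rewrite s1 => xs; exists u; rewrite pa; split=> //.
    have [E|[E|]] := arc_lt aG; last by rewrite na.
      by move: xs; rewrite sf E /= mem_head.
    by move: xs; rewrite -[f a.2]/(nt a) -E na us.
  + rewrite s2 => ys; exists z; rewrite pb; split=> //.
    have [E|[E|]] := arc_lt bG; last by rewrite nb.
      by move: ys; rewrite sb E /= mem_head.
    by move: ys; rewrite -[f b.1]/(nf b) E nb zs.
- by rewrite na nb lt_uz.
- rewrite /Phi mul2n -addnn /=.
  apply: leq_trans (leq_add (phi_visit _ _ _ _ _ _) (phi_visit _ _ _ _ _ _)) _.
  by rewrite addnACA leq_add2r.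
Qed.

Lemma park_step_ok tp st u z :
  search_ok tp st -> selectable st (u, z) -> ~~ lti o u z ->
  search_ok tp (park_step u z st) /\ Phi (park_step u z st) < Phi st.
Proof.
case=> core sf sb T pairs [/= ua za us] nlt.
have [E1 E2 L1 L2 ok1 ok2] := core.
rewrite /park_step /before /pos E2.
have park1 (c : bool) x sd : seen (if c then park x sd else sd) = seen sd by case: c.
split.
  split=> /=; [|by move=> y; rewrite park1|by move=> y; rewrite park1| |by []];
    last exact: park_threshold_ok.
  by split=> //=; case: ifP => // _; apply: park_ok.
have uo : u \in o.
  have [] // : fw_prop u by apply: (seen_prop ok1); apply: (cand_seen ok1); rewrite inE ua.
rewrite /Phi /=.
have H1 : lti o (thr st) u ->
    phi d le_fw (thr st) (park u (fw st)) < phi d le_fw (thr st) (fw st).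
  move=> lt_su; apply: phi_park => //; first by rewrite /le_fw -ltnNge.
  by apply: contraTneq lt_su => ->; rewrite /lti ltnn.
have H2 : lti o z (thr st) ->
    phi d le_bw (thr st) (park z (bw st)) < phi d le_bw (thr st) (bw st).
  move=> lt_su; apply: phi_park => //; first by rewrite /le_bw -ltnNge.
  by apply: contraTneq lt_su => ->; rewrite /lti ltnn.
case: ifP => [/H1 h1|c1]; case: ifP => [/H2 h2|c2].
- by rewrite -addSn leq_add // ltnW.
- by rewrite ltn_add2r.
- by rewrite ltn_add2l.
case: us; have Euz : index u o = index z o.
  by move: nlt c1 c2; clear; rewrite /lti; lia.
have Eus : index u o = index (thr st) o.
  by move: nlt c1 c2; clear; rewrite /lti; lia.
by rewrite -(index_eq uo Eus) -(index_eq uo Euz).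
Qed.

(* [u_i < z_i] in the old order, so no old path leads from [z_i] to [u_j <= u_i],
   while the new arc provides one: the search creates the related pairs
   [(b_i, a_j)] for all [i, j] with [u_j <= u_i]. *)
Lemma search_related tp st : search_ok tp st ->
  size tp ^ 2 + 2 * #|related G| <= 2 * #|related G'|.
Proof.
case=> [[_ _ _ _ okF okB]] _ _ _ /allP pairs.
pose ab i := nth ((v, w), (v, w)) tp i.
pose k := size tp; pose h (ij : 'I_k * 'I_k) := ((ab ij.1).2, (ab ij.2).1).
pose swap (ij : 'I_k * 'I_k) := (ij.2, ij.1).
pose key i := index (nf (ab i).1) o.
pose N := [set ij : 'I_k * 'I_k | key ij.2 <= key ij.1].
have abP (i : 'I_k) : ab i \in tp by apply: mem_nth.
have h_inj : injective h.
  move=> [i j] [i' j'] [E2 E1]; congr (_, _); apply/val_inj/eqP => /=.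
    rewrite -(nth_uniq (v, w) _ _ (trace_uniq okB)) ?size_map //.
    by rewrite !(nth_map ((v, w), (v, w))) //; apply/eqP.
  rewrite -(nth_uniq (v, w) _ _ (trace_uniq okF)) ?size_map //.
  by rewrite !(nth_map ((v, w), (v, w))) //; apply/eqP.
have swap_inj : injective swap by move=> [i j] [i' j'] [-> ->].
have cardN : k ^ 2 <= 2 * #|N|.
  have <- : #|[set: 'I_k * 'I_k]| = k ^ 2 by rewrite cardsT card_prod card_ord.
  rewrite mul2n -addnn -{2}(card_imset _ swap_inj).
  apply: leq_trans (leq_card_setU _ _); apply/subset_leq_card/subsetP => ij _.
  rewrite !inE; case/orP: (leq_total (key ij.2) (key ij.1)) => [->//|le_ij].
  by apply/orP; right; apply/imsetP; exists (swap ij); [rewrite inE|case: (ij)].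
have subN : h @: N \subset related G' :\: related G.
  apply/subsetP => _ /imsetP[[i j] + ->]; rewrite inE /= => le_ji.
  have [aG sa] : (ab j).1 \in G' /\ nf (ab j).1 \in seen (fw st).
    by apply: (trace_sound okF); apply: map_f.
  have [bG sb] : (ab i).2 \in G' /\ nt (ab i).2 \in seen (bw st).
    by apply: (trace_sound okB); apply: map_f.
  have [_ ca _] := seen_prop okF sa; have [_ cb _] := seen_prop okB sb.
  rewrite inE; apply/andP; split; rewrite inE /=; last first.
    rewrite aG bG /=.
    have /andP[c1 _] := find_conn comps (ab i).2.2.
    have /andP[_ c2] := find_conn comps (ab j).1.1.
    have c0 : conn G' v w by apply: connect1; rewrite setU11.
    exact: conn_trans c1 (conn_trans cb (conn_trans c0 (conn_trans ca c2))).
  apply: contraL le_ji => /and3P[_ _ c]; rewrite -ltnNge.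
  have lt_ii : key i < index (nt (ab i).2) o by apply: pairs (abP i).
  apply: leq_trans lt_ii _.
  by have [E|/ltnW] := order_conn Htopo c; rewrite /key /nf -?E.
have sub : related G \subset related G'.
  apply/subsetP => p; rewrite !inE => /and3P[-> -> c]; rewrite !orbT /=.
  exact: conn_sub (subsetU1 _ _) c.
apply: leq_trans (leq_add cardN (leqnn _)) _; rewrite -mulnDr leq_mul2l /=.
rewrite -(card_imset _ h_inj); apply: leq_trans (leq_add (subset_leq_card subN) (leqnn _)) _.
by rewrite cardsDS // subnK // subset_leq_card.
Qed.

Definition exhausted (st : search n) : Prop :=
  forall x y, ptr (fw st) x != None -> ptr (bw st) y != None -> ~~ lti o x y.

Definition active_sides (st : search n) : nat :=
  (act (fw st) != set0) + (act (bw st) != set0).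

Section Budget.
Variables (R : realFieldType) (comb : combiner R n).
Hypothesis Hc : central d comb.

Lemma rethreshold_budget tp st (B : R) : search_ok tp st ->
  budget comb (rethreshold st)
    (fun st' b => [/\ search_ok tp st', settled (fw st'), settled (bw st') &
       (B + (Phi st' + active_sides st')%:R <= b)%R])
    (B + (Phi st + 2)%:R)%R.
Proof.
case=> core sf sb T pairs; have [E1 E2 L1 L2 ok1 ok2] := core.
rewrite /rethreshold /pos E2; apply: (budget_bind Hc).
have inj1 : {in pas (fw st) &, injective (index^~ o)}.
  move=> x y xp _ /index_eq; apply.
  by have [] := seen_prop ok1 (cand_seen ok1 (_ : x \in _)); rewrite ?inE ?xp ?orbT.
have inj2 sd : shrinks (bw st) sd -> {in pas sd &, injective (index^~ o)}.
  move=> [_ _ sub] x y xp _ /index_eq; apply.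
  by have [] := seen_prop ok2 (cand_seen ok2 (sub x _)); rewrite ?inE ?xp ?orbT.
have le1 x s : le_fw x s = ~~ lti o s x by rewrite /lti -leqNgt.
have le2 x s : le_bw x s = ~~ lti o x s by rewrite /lti -leqNgt.
have tr2 : transitive (fun x y => lti o y x).
  by move=> x y z yx xz; apply: lti_trans xz yx.
have := refill_budget le_bw (B + 1)%R Hc inj1 (or_introl (fun x y => erefl))
  le1 (@lti_trans _ o) T.
move=> /(budget_weaken (Q' := _)) H1; apply: (budget_le Hc); first apply: H1.
  move=> [[F1 B1] s1] b1 [[T1 shF shB] setF setB actB leb]; apply: (budget_bind Hc).
  have := refill_budget le_fw (B + (act F1 != set0)%:R)%R Hc (inj2 _ shB)
    (or_intror (fun x y => erefl)) le2 tr2 (threshold_okC T1).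
  move=> /(budget_weaken (Q' := _)) H2; apply: (budget_le Hc); first apply: H2.
    move=> [[B2 F2] s2] b2 [[T2 shB2 shF2] setB2 setF2 actF2 leb2].
    exists b2 => //.
    have shF' := shrinks_trans shF shF2; have shB' := shrinks_trans shB shB2.
    split=> //=; last 1 first.
    - apply: le_trans leb2; rewrite -addrA lerD2l -natrD ler_nat /Phi /active_sides /=.
      have : (act F2 != set0) <= (act F1 != set0).
        case: eqP => // /eqP; case/set0Pn => x /(subsetP actF2) xF.
        by case: eqP xF => // ->; rewrite inE.
      rewrite addnACA; move: (phi _ _ _ _) (phi _ _ _ _) => p q.
      by move: (nat_of_bool _) (nat_of_bool _) (nat_of_bool _) => i j l; lia.
    - split=> //=.
      + by split=> //=; [apply: shrinks_ok shF' ok1|apply: shrinks_ok shB' ok2].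
      + by move=> x; case: shF' => -> _ _.
      + by move=> x; case: shB' => -> _ _.
      + by move: (threshold_okC T2).
    - exact: setF2.
  apply: le_trans leb; rewrite -[1%R]/(1%:R)%R -!addrA lerD2l -!natrD ler_nat.
  move: (phi _ _ _ _) (phi _ _ _ _) (nat_of_bool _) => p q i; lia.
rewrite -[1%R]/(1%:R)%R -!addrA lerD2l -!natrD ler_nat /Phi.
by move: (phi _ _ _ _) (phi _ _ _ _) => p q; lia.
Qed.

Lemma finished_exhausted tp st : search_ok tp st ->
  settled (fw st) -> settled (bw st) -> finished st -> exhausted st.
Proof.
case=> _ _ _ [T1 T2 T3] _ setF setB fin x y px py; apply/negP => lt_xy.
have [] := T3 x y px py lt_xy; rewrite /cand !inE; case/or3P: fin.
- by move/eqP => E; rewrite E (setF E) !inE.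
- by move/eqP => E; rewrite E (setB E) !inE.
case/andP => /eqP-> /eqP->; rewrite !inE => /orP xs /orP ys.
have : index (thr st) o <= index x o by case: xs => [/eqP->//|/T1/ltnW].
have : index y o <= index (thr st) o by case: ys => [/eqP->//|/T2/ltnW].
by move=> le1 le2; have := leq_trans lt_xy (leq_trans le1 le2); rewrite ltnn.
Qed.

Let cost := (2 * d.+2).+1.

Lemma search_loop_budget (W : R) fuel tp st :
  (forall tp' st', search_ok tp' st' -> ((cost * size tp')%:R <= W)%R) ->
  search_ok tp st -> settled (fw st) -> settled (bw st) ->
  budget comb (search_loop fuel st)
    (fun st' b => exists tp', [/\ search_ok tp' st', exhausted st' &
       (W - (cost * size tp')%:R <= b)%R])
    (W - (cost * size tp)%:R + (Phi st + active_sides st)%:R)%R.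
Proof.
move=> HW; elim: fuel tp st => [|fuel IH] tp st ok setF setB /=; case: ifPn => fin.
- exists (W - (cost * size tp)%:R)%R; first by rewrite lerDl.
  by exists tp; split=> //; apply: finished_exhausted ok _ _ _.
- by apply: addr_ge0 => //; rewrite subr_ge0; apply: HW ok.
- exists (W - (cost * size tp)%:R)%R; first by rewrite lerDl.
  by exists tp; split=> //; apply: finished_exhausted ok _ _ _.
move=> [u z] sel /=; have [/= ua za _] := sel.
have -> : active_sides st = 2.
  by move: fin; rewrite /finished /active_sides; case: eqP; case: eqP.
apply: (budget_bind Hc).
have next tp1 st1 : search_ok tp1 st1 ->
    cost * size tp + (Phi st1).+1 <= cost * size tp + Phi st +
      (cost * size tp1 - cost * size tp) ->
    size tp <= size tp1 ->
    budget comb (rethreshold st1) (fun st' b => budget comb (search_loop fuel st')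
      (fun st' b => exists tp', [/\ search_ok tp' st', exhausted st' &
       (W - (cost * size tp')%:R <= b)%R]) b)
    (W - (cost * size tp)%:R + (Phi st + 2)%:R - 1)%R.
  move=> ok1 le1 le_sz.
  have H := rethreshold_budget (W - (cost * size tp1)%:R)%R ok1.
  apply: (budget_le Hc); first apply: budget_weaken H.
    by move=> st' b [ok' sF' sB' leb]; apply: (budget_le Hc) leb; apply: IH.
  have {}le1 : (cost * size tp + Phi st1 + 1 <= Phi st + cost * size tp1)%N.
    have : cost * size tp <= cost * size tp1 by rewrite leq_mul2l le_sz orbT.
    move: le1; clear; move: (cost * _) (cost * _) => p q; lia.
  move: le1; clear; move: (cost * _) (cost * _) (Phi st1) (Phi st) => q p r t.
  rewrite -(ler_nat R) (natrD _ _ 1) (natrD _ p) (natrD _ t q) !(natrD _ _ 2).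
  by move: p%:R%R q%:R%R r%:R%R t%:R%R => p' q' r' t'; lra.
rewrite /before /pos (core_order (search_core ok)).
case: ifPn => lt_uz.
  have [ab [ok1 le1]] := search_step_ok ok ua za lt_uz.
  apply: next ok1 _ _; last exact: leqnSn.
  by rewrite [size (_ :: _)]/= mulnS addnK -addnA leq_add2l /cost addnS ltnS.
have [ok1 lt1] := park_step_ok ok sel lt_uz.
by apply: next ok1 _ _ => //; rewrite subnn addn0 leq_add2l.
Qed.

End Budget.
End Search.

(** * Components and order after a search *)

Lemma pairwise_lt_index (T : eqType) (r : rel T) (s : seq T) x y :
  pairwise r s -> x \in s -> y \in s -> x != y -> ~~ r y x ->
  index x s < index y s.
Proof.
move=> /(pairwiseP x) pw xs ys xy; apply: contraNT; rewrite -leqNgt leq_eqVlt.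
case/predU1P => [E|lt_yx]; first by rewrite -(nth_index x xs) -E nth_index ?eqxx in xy.
by have := pw _ _ _ _ lt_yx; rewrite !inE !index_mem !nth_index // => ->.
Qed.

Lemma pairwise_index (T : eqType) (s : seq T) :
  uniq s -> pairwise (fun x y => index x s < index y s) s.
Proof.
move=> us; case: s us => // x0 s us; apply/(pairwiseP x0) => i j; rewrite !inE => li lj lt_ij.
by rewrite !index_uniq.
Qed.

Section Restore.
Variables (n : nat) (G : {set darc n}) (v w : 'I_n).
Variables (f : 'I_n -> 'I_n) (o : seq 'I_n).
Let G' := (v, w) |: G.
Hypothesis comps : comps_ok G' f o.
Hypothesis Htopo : topo G f o.
Hypothesis Hcyc : lti o (f w) (f v).
Let nf (a : darc n) := f a.1.
Let nt (a : darc n) := f a.2.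
Notation cv := (f v).
Notation cw := (f w).

Variables (F B : {set 'I_n}) (t : 'I_n).
Hypothesis F_prop : forall x, x \in F -> fw_prop G v w f o x.
Hypothesis B_prop : forall x, x \in B -> bw_prop G v w f o x.
Hypothesis cwF : cw \in F.
Hypothesis cvB : cv \in B.
Hypothesis tF : t = cv \/ t \in F.
Hypothesis t_le : ~~ lti o cv t.
Hypothesis F_closed : forall a, a \in G' -> nf a \in F -> lti o (nf a) t -> nt a \in F.
Hypothesis B_closed : forall a, a \in G' -> nt a \in B -> lti o t (nt a) -> nf a \in B.

Let Flt := [set x in F | lti o x t].
Let Bgt := [set y in B | lti o t y].
Let X := t |: (Flt :|: Bgt).

Variable Y : seq (darc n).
Hypothesis Y_sound : forall p, p \in Y ->
  p = (cv, cw) \/ exists a, [/\ a \in G', p = (nf a, nt a) & nf a != nt a].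
Hypothesis cvcwY : (cv, cw) \in Y.
Hypothesis Y_full : forall a, a \in G' -> nf a != nt a ->
  (nf a \in Flt) || (nt a \in Bgt) -> (nf a, nt a) \in Y.

Let fK := find_idem comps.

Lemma lti_irr x : lti o x x = false.
Proof. exact: ltnn. Qed.

Lemma lti_total x y : x \in o -> x != y -> ~~ lti o x y -> lti o y x.
Proof.
move=> xo xy; rewrite /lti -leqNgt leq_eqVlt => /predU1P[/esym/(index_eq xo) E|//].
by rewrite E eqxx in xy.
Qed.

Lemma t_o : t \in o.
Proof. by case: tF => [->|/F_prop[]//]; apply: find_order comps _. Qed.

Lemma conn_find x y : conn G' (f x) y = conn G' x y.
Proof.
have /andP[c1 c2] := find_conn comps x.
by apply/idP/idP; apply: conn_trans.
Qed.

Lemma conn_findr x y : conn G' x (f y) = conn G' x y.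
Proof.
have /andP[c1 c2] := find_conn comps y.
by apply/idP/idP => c; apply: conn_trans c _.
Qed.

Lemma conn_new : conn G' v w.
Proof. by apply: connect1; rewrite setU11. Qed.

Lemma arcP a : a \in G' -> [\/ a = (v, w), nf a = nt a | lti o (nf a) (nt a)].
Proof. by case/(arc_lt Htopo) => [E|[E|E]]; [constructor 1|constructor 2|constructor 3]. Qed.

Lemma reach_F x : conn G' w x -> lti o (f x) t -> f x \in F.
Proof.
move=> wx; apply: (conn_ind (P := fun z => lti o (f z) t -> f z \in F) _ wx) => //.
move=> a aG IH; case: (arcP aG) => [->//|E|lt_a].
  by move: IH; rewrite [f a.1]E.
by move=> lt_t; apply: F_closed (IH _) _ => //; apply: lti_trans lt_t.
Qed.

Lemma reach_B x : conn G' x v -> lti o t (f x) -> f x \in B.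
Proof.
move=> xv; apply: (conn_ind_r (P := fun z => lti o t (f z) -> f z \in B) _ xv) => //.
move=> a aG IH; case: (arcP aG) => [->//|E|lt_a].
  by move: IH; rewrite -[f a.2]E.
by move=> lt_t; apply: B_closed (IH _) _ => //; apply: lti_trans lt_a.
Qed.

Definition cycle_set := [set x | [&& f x == x, conn G' w x & conn G' x v]].
Let K := cycle_set.

Lemma cycle_setP x : reflect [/\ f x = x, conn G' w x & conn G' x v] (x \in K).
Proof. by rewrite inE; apply: (iffP and3P) => [[/eqP]|[/eqP]]. Qed.

Lemma cycle_set_X x : x \in K -> x \in X.
Proof.
case/cycle_setP => fx wx xv; rewrite !inE.
have xo : x \in o by rewrite (order_mem comps) fx.
have := reach_F wx; have := reach_B xv; rewrite fx.
have [->|xt] := eqVneq x t; first by [].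
have [lt_xt|/(lti_total xo xt) lt_tx] := boolP (lti o x t).
  by move=> _ ->.
by move=> -> // _; rewrite lt_tx orbT.
Qed.

Lemma cycle_set_arc a : a \in G' -> nf a \in K -> nt a \in K ->
  nf a != nt a -> (nf a, nt a) \in Y.
Proof.
move=> aG /cycle_setP[p1 p2 p3] /cycle_setP[q1 q2 q3] pq.
case: (arcP aG) => [->//|E|lt_a]; first by rewrite E eqxx in pq.
apply: Y_full => //; rewrite !inE.
have := reach_F p2; have := reach_B q3; rewrite p1 q1.
have [lt_pt|ge] := boolP (lti o (nf a) t); first by move=> _ ->.
move=> H _; have lt_tq : lti o t (nt a).
  by move: ge lt_a; rewrite /lti -leqNgt; apply: leq_ltn_trans.
by rewrite lt_tq H ?orbT.
Qed.

Let e := [rel x y | [&& x \in X, y \in X & (x, y) \in Y]].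

Lemma cycle_set_connect x y : x \in K -> y \in K -> connect e x y.
Proof.
move=> /cycle_setP[x1 x2 x3] /cycle_setP[y1 y2 y3].
have xy : conn G' x y := conn_trans x3 (conn_trans conn_new y2).
suff [_ /(_ y3)] : conn G' x y /\ (conn G' y v -> connect e x (f y)) by rewrite y1.
apply: (conn_ind (P := fun z => conn G' x z /\ (conn G' z v -> connect e x (f z))) _ xy).
  move=> a aG [xa IH]; have a12 := conn_arc aG.
  have xa2 := conn_trans xa a12; split=> // av; have a1v := conn_trans a12 av.
  apply: connect_trans (IH a1v) _.
  have [->//|ne] := eqVneq (f a.1) (f a.2); apply: connect1 => /=.
  have K1 : nf a \in K.
    by apply/cycle_setP; rewrite /nf fK conn_find conn_findr; split=> //; apply: conn_trans xa.
  have K2 : nt a \in K.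
    by apply/cycle_setP; rewrite /nt fK conn_find conn_findr; split=> //;
      apply: conn_trans xa2.
  by rewrite !cycle_set_X //= cycle_set_arc.
by split; [exact: connect0|rewrite x1 connect0].
Qed.

Lemma strong_arc x y : e x y -> conn G' x y /\ (x = cv /\ y = cw \/ lti o x y).
Proof.
case/and3P => _ _ /Y_sound[[-> ->]|[a [aG [-> ->] ne]]].
  by rewrite conn_find conn_findr conn_new; split=> //; left.
rewrite conn_find conn_findr conn_arc //; split=> //.
by case: (arcP aG) => [->|E|]; [left|rewrite E eqxx in ne|right].
Qed.

Lemma connect_strong x y : connect e x y ->
  conn G' x y /\ [\/ x = y, lti o x y | conn G' x v /\ conn G' w y].
Proof.
case/connectP=> p; elim: p x => [|z p IH] x /=.
  by move=> _ ->; split; [exact: connect0|constructor 1].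
case/andP => /strong_arc[xz xz'] pz yl; have [zy zy'] := IH z pz yl.
split; first exact: conn_trans zy.
case: xz' => [[Ex Ez]|lt_xz].
  constructor 3; rewrite Ex conn_find conn_refl; split=> //.
  by rewrite -(conn_find w) -Ez.
case: zy' => [<-|lt_zy|[zv wy]]; [by constructor 2| |].
  by constructor 2; apply: lti_trans lt_zy.
by constructor 3; split=> //; apply: conn_trans zv.
Qed.

Lemma X_find x : x \in X -> f x = x.
Proof.
move=> xX; apply/eqP; rewrite -(order_mem comps); move: xX.
by rewrite !inE => /or3P[/eqP->|/andP[/F_prop[]//]|/andP[/B_prop[]//]]; exact: t_o.
Qed.

Lemma new_componentE : new_component X Y = K.
Proof.
have cls x : x \in X -> [set y in X | strong X Y x y] \in equivalence_partition (strong X Y) X.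
  by move=> xX; apply/imsetP; exists x.
rewrite /new_component; case: pickP => [K0 /andP[]|none] /=.
  case/imsetP => x0 x0X -> /card_gt1P[x [y []]].
  move=> /setIdP[xX /andP[x0x xx0]] /setIdP[yX /andP[x0y yx0]] xy.
  have xy1 := connect_trans xx0 x0y; have yx1 := connect_trans yx0 x0x.
  have [cv1 cw1] : conn G' x v /\ conn G' w x.
    have [xy2 c1] := connect_strong xy1; have [yx2 c2] := connect_strong yx1.
    case: c1 => [E|lt1|[c3 c4]]; first by rewrite E eqxx in xy.
      case: c2 => [E|lt2|[c3 c4]]; first by rewrite E eqxx in xy.
        by have := lti_trans lt1 lt2; rewrite lti_irr.
      by split=> //; apply: conn_trans c3.
    by split=> //; apply: conn_trans yx2.
  have xK : x \in K by apply/cycle_setP; rewrite X_find.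
  apply/setP => z; apply/idP/idP.
    move=> /setIdP[zX /andP[x0z zx0]].
    have [zx _] := connect_strong (connect_trans zx0 x0x).
    have [xz _] := connect_strong (connect_trans xx0 x0z).
    by apply/cycle_setP; rewrite X_find // (conn_trans cw1 xz) (conn_trans zx cv1).
  move=> zK; apply/setIdP; rewrite cycle_set_X //=; split=> //.
  apply/andP; split; first exact: connect_trans x0x (cycle_set_connect xK zK).
  exact: connect_trans (cycle_set_connect zK xK) xx0.
apply/esym/eqP; rewrite -subset0; apply/subsetP => x /cycle_setP[x1 x2 x3].
have wv := conn_trans x2 x3.
have cvK : cv \in K by apply/cycle_setP; rewrite fK conn_find conn_findr conn_refl.
have cwK : cw \in K by apply/cycle_setP; rewrite fK conn_find conn_findr conn_refl.
have := none [set y in X | strong X Y cv y]; rewrite cls ?cycle_set_X //=.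
suff -> : 1 < #|[set y in X | strong X Y cv y]| by [].
apply/card_gt1P; exists cv, cw; split.
- by apply/setIdP; split; [exact: cycle_set_X|apply/andP; split; exact: connect0].
- by apply/setIdP; split; [exact: cycle_set_X|apply/andP; split; exact: cycle_set_connect].
- by apply: contraTneq Hcyc => ->; rewrite lti_irr.
Qed.

Variables (fl bl : seq 'I_n).
Hypothesis fl_topo : topological Y Flt fl.
Hypothesis bl_topo : topological Y Bgt bl.

(* If [t = cv] then [B_>] is empty; treating [cv] as the block [B_>] in that
   case gives both kinds of reordering the same shape. *)
Let bl' := if t == cv then [:: cv] else bl.

Lemma mem_fl x : (x \in fl) = (x \in Flt).
Proof. by case: fl_topo => /perm_mem -> _; rewrite mem_enum. Qed.

Lemma mem_bl x : (x \in bl) = (x \in Bgt).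
Proof. by case: bl_topo => /perm_mem -> _; rewrite mem_enum. Qed.

Lemma uniq_fl : uniq fl.
Proof. by case: fl_topo => /perm_uniq -> _; rewrite enum_uniq. Qed.

Lemma uniq_bl' : uniq bl'.
Proof.
rewrite /bl'; case: eqP => // _.
by case: bl_topo => /perm_uniq -> _; rewrite enum_uniq.
Qed.

Lemma cv_bl' : cv \in bl'.
Proof.
rewrite /bl'; case: eqP => [_|/eqP ne]; first exact: mem_head.
by rewrite mem_bl inE cvB lti_total ?(find_order comps) // eq_sym.
Qed.

Lemma bl'_B x : x \in bl' -> x \in B.
Proof.
rewrite /bl'; case: eqP => _; last by rewrite mem_bl inE => /andP[].
by rewrite inE => /eqP->.
Qed.

Lemma bl'_ge x : x \in bl' -> lti o x t = false.
Proof.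
rewrite /bl'; case: eqP => [->|_]; first by rewrite inE => /eqP->; rewrite lti_irr.
rewrite mem_bl inE => /andP[_]; rewrite /lti => /ltnW; rewrite leqNgt.
by move/negbTE.
Qed.

Definition zone x : nat :=
  if x \in bl' then 1 else if x \in fl then 2 else if lti o x t then 0 else 3.

Definition zone_index x : nat :=
  if x \in bl' then index x bl' else if x \in fl then index x fl else index x o.

Definition zone_lt : rel 'I_n := fun x y =>
  (zone x < zone y) || (zone x == zone y) && (zone_index x < zone_index y).

Lemma zone_lt_irr : irreflexive zone_lt.
Proof. by move=> x; rewrite /zone_lt !ltnn andbF. Qed.

Lemma zone_lt_asym x y : zone_lt x y -> ~~ zone_lt y x.
Proof. by rewrite /zone_lt; lia. Qed.

Lemma zone_bl' x : x \in bl' -> zone x = 1.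
Proof. by rewrite /zone => ->. Qed.

Lemma zone_low x : x \notin bl' -> x \notin fl -> lti o x t -> zone x = 0.
Proof. by rewrite /zone => /negbTE-> /negbTE-> ->. Qed.

Lemma bl_lt_cv x : conn G' x v -> x \in Bgt -> x != cv -> t != cv ->
  index x bl < index cv bl.
Proof.
move=> xv xB xcv tcv.
have cvBgt : cv \in Bgt by rewrite inE cvB lti_total ?(find_order comps) // eq_sym.
have fx : f x = x by apply: X_find; rewrite !in_setU xB !orbT.
suff H : lti o t (f x) -> f x \in Bgt /\ index (f x) bl <= index cv bl.
  have [] := H; first by rewrite fx; move: xB; rewrite inE => /andP[].
  rewrite fx => _; rewrite leq_eqVlt => /predU1P[/index_eq E|//].
  by rewrite E ?mem_bl ?eqxx in xcv.
apply: (conn_ind_r (P := fun z => lti o t (f z) ->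
  f z \in Bgt /\ index (f z) bl <= index cv bl) _ xv).
  move=> a aG IH; case: (arcP aG) => [-> _//|E|lt_a lt_t].
    by rewrite [f a.1]E.
  have [a2 le_a2] := IH (lti_trans lt_t lt_a).
  have a1 : nf a \in Bgt.
    rewrite inE B_closed //; first by move: a2; rewrite inE => /andP[].
    exact: lti_trans lt_t lt_a.
  split=> //; apply: leq_trans le_a2; apply/ltnW.
  have ne : nf a != nt a by apply: contraTneq lt_a => ->; rewrite lti_irr.
  case: bl_topo => _ /pairwise_lt_index; apply; rewrite ?mem_bl //.
  by rewrite negbK Y_full // a2 orbT.
by [].
Qed.

Lemma zone_to_v x : f x = x -> conn G' x v -> x \notin K -> x \notin bl' ->
  zone x = 0.
Proof.
move=> fx xv xK xb.
have Fx : x \in F -> False.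
  move=> /F_prop[_ wx _]; case/negP: xK.
  by apply/cycle_setP; split=> //; rewrite /G' in wx *.
apply: zone_low => //; first by apply/negP; rewrite mem_fl inE => /andP[/Fx].
apply: contraNT xb => ge; rewrite /bl'.
have [E|ne] := eqVneq x t.
  by case: tF => [tcv|]; [rewrite tcv eqxx E tcv mem_head|rewrite -E => /Fx].
have lt_tx : lti o t x by apply: lti_total ge => //; rewrite (order_mem comps) fx.
have xB : x \in B by have := reach_B xv; rewrite fx; apply.
case: eqP => [tcv|_]; last by rewrite mem_bl inE xB.
by have [_ _] := B_prop xB; rewrite -tcv lt_tx.
Qed.

Let f' x := if f x \in K then cv else f x.

Lemma arc_zone_lt a : a \in G' -> f' a.1 != f' a.2 -> zone_lt (f' a.1) (f' a.2).
Proof.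
move=> aG; rewrite /f' -/(nf a) -/(nt a).
have fp : f (nf a) = nf a by apply: fK.
have fq : f (nt a) = nt a by apply: fK.
have pq : conn G' (nf a) (nt a) by rewrite conn_find conn_findr conn_arc.
have cvK z : z \in K -> cv \in K.
  case/cycle_setP => _ wz zv; apply/cycle_setP.
  by rewrite fK conn_find conn_findr conn_refl (conn_trans wz zv).
case: ifPn => pK; case: ifPn => qK; rewrite ?eqxx // => ne.
- have [_ wp _] := cycle_setP _ pK; have wq := conn_trans wp pq.
  have qb : nt a \notin bl'.
    apply: contra qK => /bl'_B/B_prop[_ qv _]; exact/cycle_setP.
  rewrite /zone_lt (zone_bl' cv_bl') /zone (negbTE qb).
  case: ifPn => // qf; case: ifPn => // lt_q; case/negP: qf.
  by rewrite mem_fl inE lt_q andbT; have := reach_F wq; rewrite fq; apply.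
- have [_ _ qv] := cycle_setP _ qK; have pv := conn_trans pq qv.
  have [pb|pb] := boolP (nf a \in bl'); last first.
    by rewrite /zone_lt (zone_to_v fp pv pK pb) (zone_bl' cv_bl').
  rewrite /zone_lt !zone_bl' ?cv_bl' //= /zone_index pb cv_bl' /bl'.
  move: pb; rewrite /bl'; case: eqP => [tcv|/eqP tcv].
    by rewrite inE (negbTE ne).
  by rewrite mem_bl => pb; apply: bl_lt_cv.
have [qb|qb] := boolP (nt a \in bl').
  have /B_prop[_ qv _] := bl'_B qb; have pv := conn_trans pq qv.
  have [pb|pb] := boolP (nf a \in bl'); last first.
    by rewrite /zone_lt (zone_to_v fp pv pK pb) zone_bl'.
  rewrite /zone_lt !zone_bl' //= /zone_index pb qb.
  move: pb qb; rewrite /bl'; case: eqP => [tcv|_].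
    by rewrite !inE => /eqP E1 /eqP E2; rewrite E1 E2 eqxx in ne.
  rewrite !mem_bl => pb qb; case: bl_topo => _ /pairwise_lt_index; apply; rewrite ?mem_bl //.
  by rewrite negbK Y_full // qb orbT.
case: (arcP aG) => [E|E|lt_a]; last 1 first.
- have low z : lti o z t -> z \in bl' -> False by move=> lt_zt /bl'_ge; rewrite lt_zt.
  rewrite /zone_lt /zone /zone_index (negbTE qb).
  have [qf|qf] := boolP (nt a \in fl).
    have lt_p : lti o (nf a) t.
      by move: qf; rewrite mem_fl inE => /andP[_]; apply: lti_trans lt_a.
    have [/(low _ lt_p)//|pb] := boolP (nf a \in bl').
    have [pf|pf] := boolP (nf a \in fl); rewrite ?lt_p //=.
    case: fl_topo => _ /pairwise_lt_index; apply=> //.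
    by rewrite negbK Y_full // -mem_fl pf.
  have [lt_q|ge_q] := boolP (lti o (nt a) t).
    have lt_p : lti o (nf a) t := lti_trans lt_a lt_q.
    have [/(low _ lt_p)//|pb] := boolP (nf a \in bl').
    have [pf|pf] := boolP (nf a \in fl); last by rewrite lt_p.
    case/negP: qf; rewrite mem_fl inE lt_q andbT; apply: F_closed => //.
    by move: pf; rewrite mem_fl inE => /andP[].
  by case: ifP => // _; case: ifP => // _; case: ifP => // _.
- move: qK qb; rewrite E /nf /nt /= => wK wb.
  rewrite /zone_lt (zone_bl' cv_bl') /zone (negbTE wb).
  case: ifPn => // wf; case: ifPn => // lt_w; case/negP: wf.
  by rewrite mem_fl inE cwF.
- by rewrite E eqxx in ne.
Qed.

Lemma reorder_shape (d : data n) : Defs.order d = o ->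
  exists A C, [/\ Defs.order (reorder cv t fl bl d) = A ++ bl' ++ fl ++ C,
    {in A, forall x, zone x = 0}, {in C, forall x, zone x = 3} &
    pairwise (lti o) A /\ pairwise (lti o) C].
Proof.
move=> Eo; have [o1 [o2 Eo12]] : exists o1 o2, o = o1 ++ t :: o2.
  by case/splitPr: t_o => o1 o2; exists o1, o2.
have uo := order_uniq comps; have := pairwise_index uo.
rewrite -/(lti o) {2}Eo12 pairwise_cat => /and3P[_ pw1 pw2].
have pw2' : pairwise (lti o) o2 by move: pw2 => /= /andP[].
have [disj t2] : ~~ has (mem o1) (t :: o2) /\ t \notin o2.
  by have := uo; rewrite Eo12 cat_uniq cons_uniq => /and3P[_ -> /andP[->]].
have t1 : t \notin o1 by apply: contra disj => t1; apply/hasP; exists t; rewrite ?mem_head.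
have it : index t o = size o1 by rewrite Eo12 index_cat (negbTE t1) /= eqxx addn0.
have lo x : x \in o1 -> lti o x t.
  by move=> x1; rewrite /lti it Eo12 index_cat x1 index_mem.
have hi x : x \in t :: o2 -> lti o x t = false.
  move=> x2; rewrite /lti it Eo12 index_cat ifN ?ltnNge ?leq_addr //.
  by apply: contra disj => x1; apply/hasP; exists x.
have tfl : t \notin fl by rewrite mem_fl inE lti_irr andbF.
have cut A C : t \notin A ->
    (take (index t (A ++ t :: C)) (A ++ t :: C) = A) *
    (drop (index t (A ++ t :: C)) (A ++ t :: C) = t :: C) *
    (take (index t (A ++ t :: C)).+1 (A ++ t :: C) = A ++ [:: t]) *
    (drop (index t (A ++ t :: C)).+1 (A ++ t :: C) = C).
  move=> tA; have -> : index t (A ++ t :: C) = size A.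
    by rewrite index_cat (negbTE tA) /= eqxx addn0.
  rewrite take_size_cat // drop_size_cat // -cat_rcons -(size_rcons A t).
  by rewrite take_size_cat // drop_size_cat // -cats1.
have filterE P : filter P o = filter P o1 ++ filter P (t :: o2) by rewrite -filter_cat -Eo12.
rewrite /reorder Eo; have [tcv|tcv] /= := eqVneq t cv.
  have blE : bl' = [:: t] by rewrite /bl' tcv eqxx.
  exists [seq x <- o1 | x \notin fl], [seq x <- o2 | x \notin fl].
  have tA : t \notin [seq x <- o1 | x \notin fl] by rewrite mem_filter (negbTE t1) andbF.
  rewrite filterE /= tfl !cut // blE -catA; split=> //.
  - move=> x; rewrite mem_filter => /andP[xf x1]; apply: zone_low => //; last exact: lo.
    by rewrite blE inE; apply: contraNneq t1 => <-.
  - move=> x; rewrite mem_filter => /andP[xf x2].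
    rewrite /zone blE inE (negbTE xf) (hi x) ?inE ?x2 ?orbT // ifN //.
    by apply: contraNneq t2 => <-.
  - split; apply: pairwise_filter; [exact: pw1|exact: pw2'].

have blE : bl' = bl by rewrite /bl' (negbTE tcv).
have tbl : t \notin bl ++ fl by rewrite mem_cat (negbTE tfl) orbF mem_bl inE lti_irr andbF.
exists [seq x <- o1 | x \notin bl ++ fl], (t :: [seq x <- o2 | x \notin bl ++ fl]).
have tA : t \notin [seq x <- o1 | x \notin bl ++ fl] by rewrite mem_filter (negbTE t1) andbF.
rewrite filterE /= tbl !cut // blE; split=> //.
- move=> x; rewrite mem_filter mem_cat negb_or => /andP[/andP[xb xf] x1].
  by apply: zone_low => //; rewrite ?blE //; apply: lo.
- move=> x x2; have [xb xf] : x \notin bl /\ x \notin fl.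
    apply/andP; rewrite -negb_or -mem_cat.
    by move: x2; rewrite inE mem_filter => /predU1P[->|/andP[]].
  rewrite /zone blE (negbTE xb) (negbTE xf) (hi x) //.
  by move: x2; rewrite !inE mem_filter => /predU1P[->|/andP[_ ->]]; rewrite ?eqxx ?orbT.
- split; first by apply: pairwise_filter; exact: pw1.
  by have := pairwise_filter (fun x => x \notin bl ++ fl) pw2; rewrite /= tbl.
Qed.

Lemma pairwise_zones A C : {in A, forall x, zone x = 0} ->
  {in C, forall x, zone x = 3} -> pairwise (lti o) A -> pairwise (lti o) C ->
  pairwise zone_lt (A ++ bl' ++ fl ++ C).
Proof.
move=> zA zC pA pC.
have zb : {in bl', forall x, zone x = 1} by move=> x; apply: zone_bl'.
have fl_bl' x : x \in fl -> x \notin bl'.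
  rewrite mem_fl inE => /andP[_ lt_x]; apply/negP => /bl'_ge; rewrite lt_x.
  by [].
have zf : {in fl, forall x, zone x = 2}.
  by move=> x xf; rewrite /zone xf (negbTE (fl_bl' x xf)).
have blocks s s' i j : {in s, forall x, zone x = i} -> {in s', forall x, zone x = j} ->
    i < j -> allrel zone_lt s s'.
  by move=> zs zs' ij; apply/allrelP => x y xs ys; rewrite /zone_lt zs // zs' // ij.
have inner (r : rel 'I_n) s i : {in s, forall x, zone x = i} -> pairwise r s ->
    {in s &, forall x y, r x y -> zone_index x < zone_index y} -> pairwise zone_lt s.
  move=> zs ps H; apply: (sub_in_pairwise (P := mem s)) ps; last exact/allP.
  by move=> x y xs ys rxy; rewrite /zone_lt !zs // ltnn eqxx H.
rewrite !pairwise_cat !allrel_catr.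
rewrite (blocks _ _ _ _ zA zb isT) (blocks _ _ _ _ zA zf isT) (blocks _ _ _ _ zA zC isT).
rewrite (blocks _ _ _ _ zb zf isT) (blocks _ _ _ _ zb zC isT) (blocks _ _ _ _ zf zC isT) /=.
apply/and4P; split.
- apply: (inner _ _ _ zA pA) => x y /zA zx /zA zy; move: zx zy; rewrite /zone /zone_index.
  by case: ifP => // _; case: ifP => // _; case: ifP => // _ _; case: ifP => // _; case: ifP.
- by apply: (inner _ _ _ zb (pairwise_index uniq_bl')) => x y xb yb; rewrite /zone_index xb yb.
- apply: (inner _ _ _ zf (pairwise_index uniq_fl)) => x y xf yf; rewrite /zone_index.
  by rewrite xf yf (negbTE (fl_bl' x xf)) (negbTE (fl_bl' y yf)).
- apply: (inner _ _ _ zC pC) => x y /zC zx /zC zy; move: zx zy; rewrite /zone /zone_index.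
  by case: ifP => // _; case: ifP => // _; case: ifP => // _ _; case: ifP => // _; case: ifP.
Qed.

Lemma reorder_mem (d : data n) : Defs.order d = o ->
  Defs.order (reorder cv t fl bl d) =i o.
Proof.
move=> Eo x; have flo z : z \in fl -> z \in o.
  by rewrite mem_fl inE => /andP[/F_prop[]].
have blo z : z \in bl -> z \in o.
  by rewrite mem_bl inE => /andP[/B_prop[]].
rewrite /reorder Eo; case: eqP => _ /=; rewrite !mem_cat orbCA orbC.
  rewrite -mem_cat cat_take_drop mem_filter.
  by case xf: (x \in fl); rewrite ?orbF // flo.
rewrite [(x \in fl) || _]orbC orbA -mem_cat cat_take_drop -orbA mem_filter mem_cat.
case xf: (x \in fl); first by rewrite orbT flo.
by case xb: (x \in bl); rewrite ?orbF // blo.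
Qed.

Definition keep : pred 'I_n := fun x => (x \notin K) || (x == cv).

Let o' (d : data n) := [seq x <- Defs.order (reorder cv t fl bl d) | keep x].

Lemma pairwise_new_order (d : data n) : Defs.order d = o -> pairwise zone_lt (o' d).
Proof.
move=> /reorder_shape[A [C [E zA zC [pA pC]]]]; rewrite /o' E.
exact/pairwise_filter/pairwise_zones.
Qed.

Lemma find_newK x : f' (f' x) = f' x.
Proof.
rewrite /f'; have [|xK] := boolP (f x \in K); last by rewrite fK (negbTE xK).
case/cycle_setP => _ wx xv; rewrite fK ifT //; apply/cycle_setP.
by rewrite fK conn_find conn_findr conn_refl (conn_trans wx xv).
Qed.

Lemma new_order_mem (d : data n) x : Defs.order d = o -> (x \in o' d) = (f' x == x).
Proof.
move=> Eo; rewrite mem_filter reorder_mem // (order_mem comps) /keep /f'.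
have [fx|fx] := eqVneq (f x) x.
  by rewrite fx andbT; case: ifPn => [_|] /=; [rewrite eq_sym|rewrite eqxx].
rewrite andbF; apply/esym; case: ifPn => _; last exact/negbTE.
by apply: contraNF fx => /eqP <-; rewrite fK.
Qed.

Lemma new_comps_ok (d : data n) : Defs.order d = o -> comps_ok G' f' (o' d).
Proof.
move=> Eo; split=> [x||x|x].
- exact: find_newK.
- exact: pairwise_uniq zone_lt_irr (pairwise_new_order Eo).
- exact: new_order_mem.
- rewrite /f'; case: ifPn => [/cycle_setP[_ wx xv]|_]; last exact: (find_conn comps).
  rewrite conn_findr in wx; rewrite conn_find in xv.
  by rewrite conn_findr conn_find xv (conn_trans conn_new wx).
Qed.

Lemma new_topo (d : data n) : Defs.order d = o -> topo G' f' (o' d).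
Proof.
move=> Eo a aG; have [->|ne] := eqVneq (f' a.1) (f' a.2); [by left|right].
apply: (pairwise_lt_index (pairwise_new_order Eo)) => //.
- by rewrite new_order_mem // find_newK.
- by rewrite new_order_mem // find_newK.
- exact/zone_lt_asym/arc_zone_lt.
Qed.

End Restore.

(** * Cost of an arc addition *)

Lemma uniq_flatten_map (T S : eqType) (L : T -> seq S) (k : S -> T) s :
  uniq s -> (forall x, uniq (L x)) -> (forall x a, a \in L x -> k a = x) ->
  uniq (flatten (map L s)).
Proof.
move=> us UL kL; elim: s us => //= x s IH /andP[xs us].
rewrite cat_uniq UL IH // andbT; apply/hasPn => a /flatten_mapP[y ys ay] /=.
by apply: contra xs => /kL <-; rewrite (kL _ _ ay).
Qed.

Lemma merge_lists_ok n (G : {set darc n}) (nr fr : darc n -> 'I_n)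
    (f : 'I_n -> 'I_n) (K : {set 'I_n}) c e (L : 'I_n -> seq (darc n)) :
  let g x := if f x \in K then c else f x in
  (forall x, x \in K -> c \in K) -> perm_eq e (enum K) ->
  lists_ok G (fun a => f (nr a)) (fun a => f (fr a)) L ->
  lists_ok G (fun a => g (nr a)) (fun a => g (fr a))
    (fun x => if x \in K then (if x == c then flatten (map L e) else [::]) else L x).
Proof.
move=> g cK pe [U S C].
have memE x : (x \in e) = (x \in K) by rewrite (perm_mem pe) mem_enum.
split=> [x|x a|a aG ne].
- case: ifP => // xK; case: eqP => // _.
  apply: (uniq_flatten_map (k := fun a => f (nr a))) => // [|y a /S[]//].
  by rewrite (perm_uniq pe) enum_uniq.
- rewrite /g; case: ifP => xK; last first.
    by move=> /S[aG ax]; rewrite ax xK.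
  case: eqP => // -> /flatten_mapP[y]; rewrite memE => yK /S[aG ay].
  by rewrite ay yK.
- have aL : a \in L (f (nr a)).
    by apply: C => //; apply: contraNneq ne => E; rewrite /g E.
  rewrite /g; have [aK|aK] := boolP (f (nr a) \in K); last by rewrite (negbTE aK).
  rewrite (cK _ aK) eqxx; apply/flatten_mapP; exists (f (nr a)) => //.
  by rewrite memE.
Qed.

Lemma exhausted_sub n (G : {set darc n}) nr (P : 'I_n -> Prop) L tr sd x :
  side_ok G nr P L tr sd -> x \in seen sd -> ptr sd x = None ->
  {subset L x <= tr}.
Proof.
move=> ok xs px; have [l1 [l2 [-> s1 _]]] := seen_split ok xs.
by rewrite px; case: l2 => // _; rewrite cats0.
Qed.

Section RestoreBudget.
Variables (n : nat) (G : {set darc n}) (v w : 'I_n) (st : search n).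
Notation D := (dat st).
Let f := fnd D.
Let o := Defs.order D.
Let G' := (v, w) |: G.
Hypothesis comps : comps_ok G' f o.
Hypothesis Htopo : topo G f o.
Hypothesis Hcyc : lti o (f w) (f v).
Variable tp : seq (darc n * darc n).
Hypothesis ok : search_ok G v w f o tp st.
Hypothesis ex : exhausted o st.
Variables (R : realFieldType) (d : nat) (comb : combiner R n).
Hypothesis Hc : central d comb.

Let F := seen (fw st).
Let B := seen (bw st).
Let live := [set x in F | ptr (fw st) x != None].
Let t := [arg min_(x < f v in f v |: live) pos D x].
Let Flt := [set x in F | before D x t].
Let Bgt := [set y in B | before D t y].
Let X := t |: (Flt :|: Bgt).
Let scan := flatten [seq outl D u | u <- enum Flt] ++
            flatten [seq inl D z | z <- enum Bgt].
Let Y := (f v, f w) :: [seq a <- [seq (fnd D b.1, fnd D b.2) | b <- scan] | a.1 != a.2].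

Let okF := core_fw (search_core ok).
Let okB := core_bw (search_core ok).
Let Lout := core_out (search_core ok).
Let Lin := core_in (search_core ok).

Lemma threshold_min :
  t \in f v |: live /\ forall x, x \in f v |: live -> index t o <= index x o.
Proof. by rewrite /t; case: arg_minnP => [|z zl zmin]; rewrite ?setU11. Qed.

Lemma threshold_cases : t = f v \/ t \in live.
Proof. by have [+ _] := threshold_min; rewrite in_setU1 => /predU1P. Qed.

Lemma before_threshold x : x \in Flt -> ptr (fw st) x = None.
Proof.
rewrite inE => /andP[xF lt_x]; apply/eqP; apply: contraTT lt_x => px.
have [_ /(_ x)] := threshold_min; rewrite /before /pos -leqNgt; apply.
by rewrite in_setU1 inE xF px orbT.
Qed.

Lemma after_threshold y : y \in Bgt -> ptr (bw st) y = None.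
Proof.
rewrite inE => /andP[yB lt_y]; apply/eqP; apply: contraTT lt_y => py.
case: threshold_cases => [->|].
  by have [_ _] := seen_prop okB yB.
by rewrite inE => /andP[_ pt]; apply: ex.
Qed.

Lemma F_fw_prop x : x \in F -> fw_prop G v w f o x.
Proof. exact: (seen_prop okF). Qed.

Lemma B_bw_prop y : y \in B -> bw_prop G v w f o y.
Proof. exact: (seen_prop okB). Qed.

Lemma start_F : f w \in F.
Proof. by rewrite (seen_fw ok) mem_head. Qed.

Lemma start_B : f v \in B.
Proof. by rewrite (seen_bw ok) mem_head. Qed.

Lemma threshold_F : t = f v \/ t \in F.
Proof. by case: threshold_cases => [|]; [left|rewrite inE => /andP[]; right]. Qed.

Lemma threshold_le : ~~ lti o (f v) t.
Proof.
have [_ /(_ (f v))] := threshold_min; rewrite /lti -leqNgt; apply.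
exact: setU11.
Qed.

Lemma fw_closed a : a \in G' -> f a.1 \in F -> lti o (f a.1) t -> f a.2 \in F.
Proof.
move=> aG aF lt_a; have [<-//|ne] := eqVneq (f a.1) (f a.2).
have aL : a \in outl D (f a.1) by apply: (lists_full Lout).
have /mapP[ab abt E] : a \in map fst tp.
  by apply: (exhausted_sub okF aF) aL; apply: before_threshold; rewrite inE aF.
by rewrite /F (seen_fw ok) inE E (map_f (fun ab : darc n * darc n => f ab.1.2)) ?orbT.
Qed.

Lemma bw_closed a : a \in G' -> f a.2 \in B -> lti o t (f a.2) -> f a.1 \in B.
Proof.
move=> aG aB lt_a; have [->//|ne] := eqVneq (f a.1) (f a.2).
have aL : a \in inl D (f a.2) by apply: (lists_full Lin) => //; rewrite eq_sym.
have /mapP[ab abt E] : a \in map snd tp.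
  by apply: (exhausted_sub okB aB) aL; apply: after_threshold; rewrite inE aB.
by rewrite /B (seen_bw ok) inE E (map_f (fun ab : darc n * darc n => f ab.2.1)) ?orbT.
Qed.

Lemma scan_arc b : b \in scan -> b \in G'.
Proof.
rewrite mem_cat => /orP[] /flatten_mapP[x _].
  by case/(lists_sound Lout).
by case/(lists_sound Lin).
Qed.

Lemma scanned_sound p : p \in Y -> p = (f v, f w) \/
  exists a, [/\ a \in G', p = (f a.1, f a.2) & f a.1 != f a.2].
Proof.
rewrite inE => /predU1P[->|]; [by left|rewrite mem_filter => /andP[+ /mapP[b bs E]]].
by rewrite E /= => ne; right; exists b; split=> //; apply: scan_arc.
Qed.

Lemma scanned_full a : a \in G' -> f a.1 != f a.2 ->
  (f a.1 \in Flt) || (f a.2 \in Bgt) -> (f a.1, f a.2) \in Y.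
Proof.
move=> aG ne H; rewrite inE mem_filter /= ne; apply/orP; right.
apply: (map_f (fun b : darc n => (f b.1, f b.2))); rewrite mem_cat.
case/orP: H => H; apply/orP; [left|right]; apply/flatten_mapP.
  by exists (f a.1); rewrite ?mem_enum //; apply: (lists_full Lout).
by exists (f a.2); rewrite ?mem_enum //; apply: (lists_full Lin); rewrite // eq_sym.
Qed.

Lemma size_scan : size scan <= 2 * size tp.
Proof.
rewrite size_cat mul2n -addnn; apply: leq_add.
  rewrite -[X in _ <= X](size_map fst); apply: uniq_leq_size.
    apply: (uniq_flatten_map (k := fun a => f a.1)); first exact: enum_uniq.
      exact: (lists_uniq Lout).
    by move=> x a /(lists_sound Lout)[].
  move=> a /flatten_mapP[x]; rewrite mem_enum => xF; apply: (exhausted_sub okF).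
    by move: xF; rewrite inE => /andP[].
  exact: before_threshold.
rewrite -[X in _ <= X](size_map snd); apply: uniq_leq_size.
  apply: (uniq_flatten_map (k := fun a => f a.2)); first exact: enum_uniq.
    exact: (lists_uniq Lin).
  by move=> x a /(lists_sound Lin)[].
move=> a /flatten_mapP[x]; rewrite mem_enum => xB; apply: (exhausted_sub okB).
  by move: xB; rewrite inE => /andP[].
exact: after_threshold.
Qed.

Lemma card_seen (sd : {set 'I_n}) x (s : seq 'I_n) : sd =i x :: s -> #|sd| <= (size s).+1.
Proof.
move=> E; rewrite (eq_card E); exact: leq_trans (card_size _) _.
Qed.

Lemma restore_budget (b0 : R) :
  budget comb (restore (f v) (f w) st)
    (fun d' b => data_ok G' d' /\ (b0 <= b)%R)
    (b0 + (15 * (size tp).+1)%:R)%R.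
Proof.
have cF : #|F| <= (size tp).+1 by have := card_seen (seen_fw ok); rewrite size_map.
have cB : #|B| <= (size tp).+1 by have := card_seen (seen_bw ok); rewrite size_map.
have cFlt : #|Flt| <= #|F| by apply/subset_leq_card/subsetP => x; rewrite inE => /andP[].
have cBgt : #|Bgt| <= #|B| by apply/subset_leq_card/subsetP => x; rewrite inE => /andP[].
have cX : #|X| <= (#|Flt| + #|Bgt|).+1.
  by rewrite cardsU1 (leq_add (leq_b1 _)) // leq_card_setU.
have cS := size_scan.
have KE : new_component X Y = cycle_set G v w f.
  apply: (new_componentE comps Htopo Hcyc F_fw_prop B_bw_prop start_F start_B
    threshold_F fw_closed bw_closed scanned_sound _ scanned_full).
  exact: mem_head.
have cK : #|new_component X Y| <= #|X|.
  rewrite KE; apply/subset_leq_card/subsetP => x.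
  exact: (cycle_set_X comps Htopo start_F start_B fw_closed bw_closed).
rewrite /restore -/f -/F -/B -/live -/t -/Flt -/Bgt -/X -/scan -/Y /=.
move=> [fl bl] [Hfl Hbl] e He; rewrite KE in cK He *.
eexists; first exact: lexx.
have KP x : x \in cycle_set G v w f -> f v \in cycle_set G v w f.
  case/cycle_setP => _ wx xv; apply/cycle_setP.
  rewrite (find_idem comps) (conn_find comps) (conn_findr comps) conn_refl.
  by rewrite (conn_trans wx xv).
split.
  split=> /=.
  - exact: (new_comps_ok comps F_fw_prop B_bw_prop threshold_F Hfl Hbl (erefl o)).
  - apply: (new_topo comps Htopo Hcyc F_fw_prop B_bw_prop start_F start_B threshold_F
      threshold_le fw_closed bw_closed _ scanned_full Hfl Hbl (erefl o)).
    exact: mem_head.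
  - exact: (merge_lists_ok KP He Lout).
  - exact: (merge_lists_ok KP He Lin).
move: cF cB cFlt cBgt cX cS cK; rewrite -!addrA lerDl.
move: #|F| #|B| #|Flt| #|Bgt| #|X| (size scan) #|cycle_set G v w f| (size tp).
by move=> *; rewrite -!opprD -!natrD subr_ge0 ler_nat; lia.
Qed.

End RestoreBudget.

Lemma insert_lists_ok n (G : {set darc n}) nr fr (L : 'I_n -> seq (darc n)) a i :
  a \notin G -> lists_ok G nr fr L ->
  lists_ok (a |: G) nr fr (fun x => if x == nr a then insert_at i a (L x) else L x).
Proof.
move=> aG [U S C].
have perm_ins l : perm_eq (insert_at i a l) (a :: l).
  by rewrite /insert_at -cat1s perm_catCA /= cat_take_drop.
split=> [x|x b|b].
- case: eqP => // _; rewrite (perm_uniq (perm_ins _)) /= U andbT.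
  by apply: contra aG => /S[].
- case: eqP => [->|_].
    rewrite (perm_mem (perm_ins _)) inE => /predU1P[->|/S[bG ->]].
      by rewrite setU11.
    by rewrite in_setU1 bG orbT.
  by move=> /S[bG ->]; rewrite in_setU1 bG orbT.
- rewrite in_setU1 => /predU1P[->|bG] ne.
    by rewrite eqxx (perm_mem (perm_ins _)) mem_head.
  case: eqP => _; last exact: C.
  by rewrite (perm_mem (perm_ins _)) inE C ?orbT.
Qed.

Section AddArc.
Variables (R : realFieldType) (n d : nat) (comb : combiner R n).
Hypothesis Hc : central d comb.

Lemma phi_start le s (L : 'I_n -> seq (darc n)) x :
  phi d le s (visit L x (empty_side n)) <= d.+2.
Proof.
apply: leq_trans (phi_visit _ _ _ _ _ _) _; rewrite -[X in _ <= X]add0n leq_add2r.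
by apply: leq_trans (phi_le _ _ _ _) _; rewrite /empty_side /= cards0 muln0.
Qed.

Lemma init_search_ok (G : {set darc n}) v w (D : data n) :
  comps_ok ((v, w) |: G) (fnd D) (Defs.order D) -> topo G (fnd D) (Defs.order D) ->
  lists_ok ((v, w) |: G) (fun a => fnd D a.1) (fun a => fnd D a.2) (outl D) ->
  lists_ok ((v, w) |: G) (fun a => fnd D a.2) (fun a => fnd D a.1) (inl D) ->
  search_ok G v w (fnd D) (Defs.order D) [::] (init_search D (fnd D v) (fnd D w)).
Proof.
move=> comps Htopo Lo Li.
have empty_ok nr P L : side_ok ((v, w) |: G) nr P L [::] (empty_side n).
  by split=> //= x; rewrite ?inE.
have seen_start (L : 'I_n -> seq (darc n)) x : seen (visit L x (empty_side n)) =i [:: x].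
  by move=> y; rewrite /visit inE /= !inE orbF.
have live_start (L : 'I_n -> seq (darc n)) x y :
    ptr (visit L x (empty_side n)) y != None -> y \in cand (visit L x (empty_side n)).
  rewrite /visit inE /cand /=; have [->|//] := eqVneq y x.
  by case: (L x) => // a l _; rewrite !inE eqxx.
have pas_start (L : 'I_n -> seq (darc n)) x : pas (visit L x (empty_side n)) = set0.
  by rewrite /visit inE.
split=> //.
- split=> //; first by apply: (visit_ok Lo) => //; apply: fw_prop_start.
  by apply: (visit_ok Li) => //; apply: bw_prop_start.
- exact: seen_start.
- exact: seen_start.
- split=> [x|y|x y]; [by rewrite pas_start inE|by rewrite pas_start inE|move=> px py _].
  by split; [exact: live_start px|exact: live_start py].
Qed.

Lemma add_arc_budget (G : {set darc n}) (D : data n) a fuel (b0 W : R) :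
  data_ok G D -> a \notin G -> (0 <= b0)%R ->
  (forall k : nat, (k ^ 2 + 2 * #|related G| <= 2 * #|related (a |: G)|)%N ->
     (((2 * d + 22) * k.+1)%N%:R <= W)%R) ->
  budget comb (add_arc fuel D a)
    (fun D' b => data_ok (a |: G) D' /\ (b0 <= b)%R) (b0 + W)%R.
Proof.
move=> ok aG b0_ge0 HW; rewrite /add_arc /= => -[i j] _.
set D' := insert_arc D a i j; case: a aG HW @D' => v w aG HW D' /=.
have [comps0 Htopo Lo0 Li0] := ok.
have comps : comps_ok ((v, w) |: G) (fnd D') (Defs.order D').
  case: comps0 => H1 H2 H3 H4; split=> // x.
  by have /andP[c1 c2] := H4 x; rewrite !(conn_sub (subsetU1 _ _)).
have Lo : lists_ok ((v, w) |: G) (fun a => fnd D' a.1) (fun a => fnd D' a.2) (outl D').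
  exact: (insert_lists_ok i aG Lo0).
have Li : lists_ok ((v, w) |: G) (fun a => fnd D' a.2) (fun a => fnd D' a.1) (inl D').
  exact: (insert_lists_ok j aG Li0).
have rel_sub : 2 * #|related G| <= 2 * #|related ((v, w) |: G)|.
  rewrite leq_mul2l /= subset_leq_card //; apply/subsetP => p.
  rewrite !inE => /and3P[-> -> c]; rewrite !orbT /=.
  exact: conn_sub (subsetU1 _ _) c.
case: ifPn => [lt_wv|ge_wv]; last first.
  exists (b0 + W - 1)%R => //; split.
    split=> // b; rewrite in_setU1 => /predU1P[->|/Htopo//] /=.
    have [E|ne] := eqVneq (fnd D v) (fnd D w); [by left|right].
    rewrite /lti ltn_neqAle leqNgt ge_wv andbT; apply: contraNneq ne => E.
    by apply/eqP; apply: index_eq E; apply: (find_order comps).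
  have := HW 0 rel_sub; rewrite muln1 natrD; move: (2 * d)%N%:R%R (ler0n R (2 * d)).
  by clear -b0_ge0; move=> u u0; lra.
have ok0 := init_search_ok comps Htopo Lo Li.
have bound tp st : search_ok G v w (fnd D') (Defs.order D') tp st ->
    (((2 * d + 22) * (size tp).+1)%N%:R <= W)%R.
  by move=> okt; apply/HW/(search_related comps Htopo okt).
have bound_split tp st : search_ok G v w (fnd D') (Defs.order D') tp st ->
    ((15 * (size tp).+1)%N%:R +
      (1 + ((2 * d + 6)%N%:R + ((2 * d.+2).+1 * size tp)%N%:R)) <= W)%R.
  move=> /bound; apply: le_trans; rewrite -[X in (_ + (X + _))%R]/(1%N%:R)%R -!natrD ler_nat.
  by move: (size tp) => k; clear; lia.
apply: (budget_bind Hc).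
have := search_loop_budget comps Htopo Hc (W := (b0 + W - 1 - (2 * d + 6)%N%:R)%R) fuel _ ok0.
move=> /(_ _ _ _) H; apply: (budget_le Hc); first apply: budget_weaken (H _ _ _).
- move=> st b [tp [okt ext leb]]; have [E1 E2 _ _ _ _] := search_core okt.
  have okt' := okt; rewrite -E1 -E2 in okt' ext.
  have comps' := comps; rewrite -E1 -E2 in comps'.
  have Htopo' : topo G (fnd D') (Defs.order D') := Htopo; rewrite -E1 -E2 in Htopo'.
  have lt' : lti (Defs.order D') (fnd D' w) (fnd D' v) := lt_wv.
  rewrite -E1 -E2 in lt'.
  have := restore_budget comps' Htopo' lt' okt' ext comb b0.
  rewrite E1 => Hr; apply: (budget_le Hc) Hr _; apply: le_trans leb.
  have := bound_split _ _ okt.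
  move: (_ * size tp)%N%:R%R (2 * d + 6)%N%:R%R (15 * _)%N%:R%R; clear.
  by move=> x y z; lra.
- move=> tp st okt; have := bound_split _ _ okt.
  move: (ler0n R (15 * (size tp).+1)%N).
  move: (_ * size tp)%N%:R%R (2 * d + 6)%N%:R%R (15 * _)%N%:R%R; clear -b0_ge0.
  by move=> x y z; lra.
- by move=> _; rewrite /= /visit inE.
- by move=> _; rewrite /= /visit inE.
have : Phi (Defs.order D') d (init_search D' (fnd D' v) (fnd D' w)) +
    active_sides (init_search D' (fnd D' v) (fnd D' w)) <= 2 * d + 6.
  apply: (@leq_trans ((d.+2 + d.+2) + (1 + 1))); last by clear; lia.
  by rewrite /Phi /active_sides !leq_add ?phi_start ?leq_b1.
rewrite muln0 -(ler_nat R); move: (_ + _)%N%:R%R (_ + _)%N%:R%R; clear.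
by move=> x y; lra.
Qed.

End AddArc.

(** * Total cost *)

Lemma card_related n (G : {set darc n}) : #|related G| <= #|G| ^ 2.
Proof.
apply: (@leq_trans #|setX G G|); last by rewrite cardsX.
by apply/subset_leq_card/subsetP => p; rewrite !inE => /and3P[-> ->].
Qed.

Lemma init_data_ok n (o : seq 'I_n) :
  perm_eq o (enum 'I_n) -> data_ok set0 (init_data o).
Proof.
move=> po; split=> /=.
- split=> [//||x|x]; first by rewrite (perm_uniq po) enum_uniq.
    by rewrite (perm_mem po) mem_enum eqxx.
  by rewrite !conn_refl.
- by move=> a; rewrite inE.
- by split=> //= a; rewrite inE.
- by split=> //= a; rewrite inE.
Qed.

Section AddArcs.
Variables (R : realFieldType) (n d m : nat) (comb : combiner R n) (r : R).
Hypothesis Hc : central d comb.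
Hypothesis r_ge1 : (1 <= r)%R.
Let alpha : R := (2 * d + 22)%N%:R%R.

Definition reserve (G : {set darc n}) (arcs : seq (darc n)) : R :=
  ((size arcs)%:R * (2 * alpha * r) +
    2 * alpha * (m%:R ^+ 2 - #|related G|%:R) / r)%R.

(* With [r = sqrt m], a search of [k] steps is charged [k <= r + k^2 / r]. *)
Lemma add_arcs_budget fuel arcs (G : {set darc n}) D :
  data_ok G D -> uniq arcs -> {in arcs, forall a, a \notin G} ->
  #|G| + size arcs <= m ->
  budget comb (add_arcs fuel D arcs) (fun _ b => (0 <= b)%R) (reserve G arcs).
Proof.
have r_gt0 : (0 < r)%R by apply: lt_le_trans r_ge1; apply: ltr01.
have a_ge0 : (0 <= alpha)%R by apply: ler0n.
have reserve_ge0 (G' : {set darc n}) s : #|G'| <= m -> (0 <= reserve G' s)%R.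
  move=> le_m; apply: addr_ge0; first by rewrite !mulr_ge0 // ltW.
  apply: divr_ge0; last exact: ltW.
  rewrite !mulr_ge0 // subr_ge0 -natrX ler_nat.
  by apply: leq_trans (card_related _) _; rewrite leq_sqr.
elim: arcs G D => [|a arcs IH] G D ok.
  move=> _ _ le_m; exists (reserve G [::]) => //.
  by apply: reserve_ge0; rewrite addn0 in le_m.
rewrite cons_uniq => /andP[a_new us] fresh le_m.
have aG : a \notin G by apply: fresh; rewrite mem_head.
have cG : #|a |: G| = #|G|.+1 by rewrite cardsU1 aG.
have le_m' : #|a |: G| + size arcs <= m by rewrite cG addSnnS.
have fresh' : {in arcs, forall b, b \notin a |: G}.
  move=> b bs; rewrite in_setU1 negb_or fresh ?inE ?bs ?orbT // andbT.
  by apply: contraNneq a_new => <-.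
pose W := (2 * alpha * r + 2 * alpha * (#|related (a |: G)|%:R - #|related G|%:R) / r)%R.
have E : reserve G (a :: arcs) = (reserve (a |: G) arcs + W)%R.
  rewrite /reserve /W -[size (_ :: _)]/((size arcs).+1) -natr1.
  move: (size arcs)%:R%R (m%:R ^+ 2)%R (#|related G|%:R)%R (#|related (a |: G)|%:R)%R.
  by move=> s M x y; lra.
rewrite E; apply: (budget_bind Hc (p := add_arc fuel D a)).
apply: budget_weaken (add_arc_budget Hc fuel ok aG _ _).
- by move=> D' b [ok' leb]; apply: (budget_le Hc) leb; apply: IH.
- by apply: reserve_ge0; apply: leq_trans le_m'; apply: leq_addr.
move=> k; rewrite -(ler_nat R) natrD natrX !(natrM _ 2) => le_k.
have kr : (k%:R <= r + k%:R ^+ 2 / r :> R)%R.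
  have [le_kr|lt_rk] := lerP k%:R%R r.
    by apply: le_trans le_kr _; rewrite lerDl divr_ge0 ?sqr_ge0 // ltW.
  apply: (@le_trans _ _ (k%:R ^+ 2 / r)%R); last by rewrite lerDr ltW.
  by rewrite ler_pdivlMr // expr2 ler_wpM2l // ltW.
have le_div : (k%:R ^+ 2 / r <= (2 * #|related (a |: G)|%:R - 2 * #|related G|%:R) / r :> R)%R.
  by rewrite ler_pM2r ?invr_gt0 // lerBrDr.
rewrite natrM -/alpha /W.
apply: (@le_trans _ _ (alpha * (r + r +
    (2 * #|related (a |: G)|%:R - 2 * #|related G|%:R) / r))%R).
  rewrite ler_wpM2l // -natr1; move: kr le_div r_ge1; clear.
  by move: (k%:R ^+ 2 / r)%R (_ / r)%R k%:R%R => x y z; lra.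
rewrite le_eqVlt; apply/orP; left; apply/eqP; rewrite -mulrBr.
move: (_ - _)%R => x; rewrite !mulrDr !mulrA; move: (_^-1)%R => y; lra.
Qed.

End AddArcs.

Section Maintain.
Variables (R : realType) (c d : nat).

Lemma powR_three_halves (m : nat) :
  (m%:R `^ (3%:R / 2%:R) = m%:R * Num.sqrt m%:R :> R)%R.
Proof.
have -> : (3%:R / 2%:R = 1 + 2%:R^-1 :> R)%R by lra.
by rewrite powRD ?powRr1 ?powR12_sqrt //; apply/implyP => /eqP; lra.
Qed.

Lemma maintain_budget (n m : nat) (comb : combiner R n) (arcs : m.-tuple (darc n))
    (o : seq 'I_n) fuel :
  central d comb -> n <= c * m -> uniq arcs -> perm_eq o (enum 'I_n) ->
  budget comb (maintain fuel o arcs) (fun _ b => (0 <= b)%R)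
    ((c + 4 * (2 * d + 22))%N%:R * m%:R `^ (3%:R / 2%:R))%R.
Proof.
move=> Hc le_n ua po; rewrite powR_three_halves /maintain /=.
have [m0|m_gt0] := posnP m.
  case: (tval arcs) (size_tuple arcs) le_n => [|a s] /=; last by rewrite m0.
  rewrite m0 muln0 leqn0 => _ /eqP ->; exists 0%R => //.
  by rewrite mul0r mulr0 subr0.
set r := Num.sqrt (m%:R : R).
have r_sqr : (r * r = m%:R)%R by rewrite -expr2 sqr_sqrtr.
have r_ge1 : (1 <= r)%R by rewrite -sqrtr1 ler_wsqrtr // ler1n.
have H := add_arcs_budget (m := m) Hc r_ge1 fuel (init_data_ok po) ua _ _.
apply: (budget_le Hc).
  by apply: H; [move=> a; rewrite inE|rewrite cards0 add0n size_tuple].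
rewrite /reserve size_tuple -[X in (_ + X)%R]mulrA.
have -> : #|related (set0 : {set darc n})| = 0.
  by apply/eqP; rewrite -leqn0; apply: leq_trans (card_related _) _; rewrite cards0.
have r_gt0 : (0 < r)%R by apply: lt_le_trans r_ge1; apply: ltr01.
have -> : ((m%:R ^+ 2 - 0%:R) / r = m%:R * r :> R)%R.
  by apply: (mulIf (lt0r_neq0 r_gt0)); rewrite divfK ?lt0r_neq0 // subr0 -mulrA r_sqr.
have le_n' : (n%:R <= c%:R * (m%:R * r) :> R)%R.
  apply: (@le_trans _ _ (c * m)%N%:R%R); first by rewrite ler_nat.
  by rewrite natrM ler_wpM2l // ler_peMr.
rewrite (natrD _ c) (natrM _ 4); move: (2 * d + 22)%N%:R%R m%:R%R c%:R%R n%:R%R le_n'.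
by move=> A M N c'; lra.
Qed.

End Maintain.

Lemma median_central (R : realFieldType) n :
  central 6 (run_comb (R := R) (@is_median n)).
Proof. by apply: run_central => r D s _ [h1 h2]; rewrite /ranks; lia. Qed.

Lemma approx_median_central (R : archiRealFieldType) n (eps : R) d :
  (3%:R <= d%:R * eps)%R -> central d (run_comb (R := R) (@is_approx_median R eps n)).
Proof.
move=> le_d; apply: run_central => r D s _ [h1 h2].
have large k : (eps * #|D|%:R <= k%:R)%R -> 3 * #|D| <= d * k.
  move=> le_k; rewrite -(ler_nat R) !natrM.
  apply: (@le_trans _ _ (d%:R * (eps * #|D|%:R))%R); last by rewrite ler_wpM2l.
  by rewrite mulrA ler_wpM2r.
by rewrite /ranks /minn; case: ifP => _; apply: large.
Qed.

Theorem theorem6p4 (R : realType) (c : nat) :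
  [/\ (exists C : R, forall (n m : nat) (arcs : m.-tuple (darc n))
         (o : seq 'I_n) (fuel T : nat),
         (n <= c * m)%N -> uniq arcs -> perm_eq o (enum 'I_n) ->
         run_cost (@is_median n) (maintain fuel o arcs) T ->
         (T%:R <= C * m%:R `^ (3%:R / 2%:R))%R),
      (forall eps : R, (0 < eps)%R -> (eps <= 1 / 2%:R)%R ->
       exists C : R, forall (n m : nat) (arcs : m.-tuple (darc n))
         (o : seq 'I_n) (fuel T : nat),
         (n <= c * m)%N -> uniq arcs -> perm_eq o (enum 'I_n) ->
         run_cost (@is_approx_median R eps n) (maintain fuel o arcs) T ->
         (T%:R <= C * m%:R `^ (3%:R / 2%:R))%R) &
      (exists C : R, forall (n m : nat) (arcs : m.-tuple (darc n))
         (o : seq 'I_n) (fuel : nat) (E : R),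
         (n <= c * m)%N -> uniq arcs -> perm_eq o (enum 'I_n) ->
         expected_cost (maintain fuel o arcs) E ->
         (E <= C * m%:R `^ (3%:R / 2%:R))%R)].
Proof.
split=> [|eps eps_gt0 _|].
- exists (c + 4 * (2 * 6 + 22))%N%:R%R => n m arcs o fuel T le_n ua po.
  by apply: run_cost_le (maintain_budget fuel (median_central R n) le_n ua po).
- set d := Num.bound (3%:R / eps)%R.
  have le_d : (3%:R <= d%:R * eps)%R.
    by rewrite -ler_pdivrMr // ltW // archi_boundP // divr_ge0 // ltW.
  exists (c + 4 * (2 * d + 22))%N%:R%R => n m arcs o fuel T le_n ua po.
  by apply: run_cost_le (maintain_budget fuel (approx_median_central n le_d) le_n ua po).
- exists (c + 4 * (2 * 24 + 22))%N%:R%R => n m arcs o fuel E le_n ua po.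
  by apply: expected_cost_le (maintain_budget fuel (mean_central R n) le_n ua po).
Qed.
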